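(* Let $u$ be a viscosity subsolution and $v$ a viscosity supersolution of $$\partial^\bullet u(x,t)+H(x,t,\nabla_\Gamma u(x,t))=0\ \text{ for }(x,t)\in S_T,\qquad u(x,0)=u_0(x)\ \text{ for }x\in\Gamma(0).$$ Suppose that $u(\cdot,0)\le v(\cdot,0)$ on $\Gamma(0)$. Then $u\le v$ on $\overline{S_T}$.
   Context: Evolving surface. $\Gamma_0\subset\mathbb{R}^3$ is a closed (compact, without boundary), connected, oriented, smooth hypersurface, $T>0$, and $\Phi:\Gamma_0\times[0,T]\to\mathbb{R}^3$ is a smooth flow map such that $\Phi(\cdot,t)$ is a diffeomorphism of $\Gamma_0$ onto a hypersurface $\Gamma(t)$, with $\Phi(X,0)=X$ and $\partial_t\Phi(X,t)=v_\Gamma(\Phi(X,t),t)$; the velocity field satisfies $v_\Gamma\in C^1(\overline{S_T})$. Here $S_T=\bigcup_{t\in(0,T)}\Gamma(t)\times\{t\}$ and $\overline{S_T}=\bigcup_{t\in[0,T]}\Gamma(t)\times\{t\}\subset\mathbb{R}^4$. $\nu(\cdot,t)$ is the unit outward normal of $\Gamma(t)$ and $P_\Gamma=I_3-\nu\otimes\nu$. For differentiable $f$, $\nabla_\Gamma f=P_\Gamma\nabla\tilde f$ is the tangential gradient ($\tilde f$ any smooth extension of $f$ to a neighbourhood), and $\partial^\bullet f$ is the material derivative, $\partial^\bullet f(\Phi(X,t),t)=\frac{d}{dt}\bigl(f(\Phi(X,t),t)\bigr)$, equivalently $\partial^\bullet f=\partial_t\tilde f+v_\Gamma\cdot\nabla\tilde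 f$. Hamiltonian and data. $u_0\in C(\Gamma(0))$, and $H:\overline{S_T}\times\mathbb{R}^3\to\mathbb{R}$ satisfies, with positive constants $L_{H,1},L_{H,2}$, for all $(x,t),(y,s)\in\overline{S_T}$, $p,q\in\mathbb{R}^3$: $|H(x,t,p)-H(y,s,p)|\le L_{H,1}(|x-y|+|t-s|)(1+|p|)$ and $|H(x,t,p)-H(x,t,q)|\le L_{H,2}|p-q|$. Viscosity solutions. $USC(\overline{S_T})$, $LSC(\overline{S_T})$ denote the upper, lower semicontinuous functions on $\overline{S_T}$. A locally bounded $u\in USC(\overline{S_T})$ (resp. $u\in LSC(\overline{S_T})$) is a viscosity subsolution (resp. supersolution) if $u(x,0)\le u_0(x)$ (resp. $u(x,0)\ge u_0(x)$) for all $x\in\Gamma(0)$ and, for any $\varphi\in C^1(\overline{S_T})$, whenever $u-\varphi$ takes a local maximum (resp. minimum) at $(x_0,t_0)\in\overline{S_T}$ with $t_0>0$ (so $t_0=T$ is allowed), then $\partial^\bullet\varphi(x_0,t_0)+H(x_0,t_0,\nabla_\Gamma\varphi(x_0,t_0))\le0$ (resp. $\ge0$). *)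

(* Defs.v *)
From HB Require Import structures.
From mathcomp Require Import all_boot all_order all_algebra.
From mathcomp Require Import all_classical all_reals all_analysis.

Set Implicit Arguments.
Unset Strict Implicit.
Unset Printing Implicit Defensive.
Import Order.TTheory GRing.Theory Num.Theory.
Import numFieldNormedType.Exports.

Local Open Scope classical_set_scope.
Local Open Scope ring_scope.

(* The library norm on 'rV[R]_n is the sup norm; [enorm] is the Euclidean one. *)
Definition dot (R : realType) (n : nat) (a b : 'rV[R]_n) : R :=
  \sum_(i < n) a 0 i * b 0 i.

Definition enorm (R : realType) (n : nat) (a : 'rV[R]_n) : R :=
  Num.sqrt (dot a a).

Definition gradient (R : realType) (n : nat) (f : 'rV[R]_n -> R)
    (x : 'rV[R]_n) : 'rV[R]_n :=
  \row_(i < n) 'D_(delta_mx 0 i) f x.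

Section Regularity.
Context {R : realType} {V W : normedModType R}.

(* C^k on an open set U; the directions v range over the whole space, which in
   finite dimension amounts to the usual condition on partial derivatives. *)
Fixpoint is_Ck (k : nat) (U : set V) (f : V -> W) : Prop :=
  match k with
  | 0%N => forall x, U x -> {for x, continuous f}
  | k'.+1 => (forall x, U x -> differentiable f x) /\
             (forall v : V, is_Ck k' U (fun x => 'D_v f x))
  end.

Definition local_extension (A : set V) (f : V -> W) (x : V)
    (U : set V) (g : V -> W) : Prop :=
  open_nbhs x U /\ forall y, A y -> U y -> g y = f y.

(* Regularity on an arbitrary (typically not open) subset A: existence of local
   extensions.  Only the values of f on A matter. *)
Definition Ck_on (k : nat) (A : set V) (f : V -> W) : Prop :=
  forall x, A x -> exists U g, local_extension A f x U g /\ is_Ck k U g.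

Definition smooth_on (A : set V) (f : V -> W) : Prop :=
  forall x, A x ->
    exists U g, local_extension A f x U g /\ forall k, is_Ck k U g.

End Regularity.

Definition diffeomorphism (R : realType) (V W : normedModType R)
    (A : set V) (B : set W) (f : V -> W) : Prop :=
  [/\ smooth_on A f, f @` A = B &
      exists2 g : W -> V, smooth_on B g & forall x, A x -> g (f x) = x].

(* f'(t) = d relative to the set I (one-sided at an end point of I). *)
Definition is_derive_within (R : realType) (W : normedModType R) (I : set R)
    (f : R -> W) (t : R) (d : W) : Prop :=
  (s - t)^-1 *: (f s - f t) @[s --> within I t^'] --> d.

Section Surfaces.
Context {R : realType}.
Local Notation E := 'rV[R]_3.
Implicit Types (M : set E) (x n w : E).

(* Smooth hypersurface of R^3: every point has a relatively open neighbourhood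
   diffeomorphic to an open subset of R^2. *)
Definition smooth_surface M : Prop :=
  forall x, M x -> exists (O : set E) (U : set 'rV[R]_2) (psi : 'rV[R]_2 -> E),
    [/\ open_nbhs x O, open U & diffeomorphism U (M `&` O) psi].

Definition tangent_vector M x w : Prop :=
  exists gamma : R -> E,
    [/\ gamma 0 = x, \forall s \near (0 : R), M (gamma s) &
        is_derive (0 : R) (1 : R) gamma w].

Definition unit_normal M x n : Prop :=
  enorm n = 1 /\ forall w, tangent_vector M x w -> dot n w = 0.

Definition oriented M : Prop :=
  exists N : E -> E,
    {within M, continuous N} /\ forall x, M x -> unit_normal M x (N x).

(* Outward: x + s n lies in the unbounded component of the complement of M for
   all small s > 0.  (connected_component A y is empty when y is not in A.) *)
Definition unit_outward_normal M x n : Prop :=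
  unit_normal M x n /\
  \forall s \near 0^'+, ~ bounded_set (connected_component (~` M) (x + s *: n)).

Definition tangential_projection n : 'M[R]_3 := 1%:M - n^T *m n.

(* w = P grad(g)(x) for a C^1 extension g of f|_M near x, where P is the
   projection given by the unit normal n of M at x.  Vectors are rows, and P is
   symmetric. *)
Definition is_tangential_gradient M n (f : E -> R) x w : Prop :=
  exists (U : set E) (g : E -> R),
    [/\ local_extension M f x U g, is_Ck 1 U g &
        w = gradient g x *m tangential_projection n].

End Surfaces.

Section EvolvingSurface.
Context {R : realType}.
Local Notation E := 'rV[R]_3.
Variables (Gamma0 : set E) (T : R) (Phi : E * R -> E).

Definition surface_at (t : R) : set E := [set Phi (X, t) | X in Gamma0].

Definition closed_spacetime : set (E * R) :=
  [set p | 0 <= p.2 <= T /\ surface_at p.2 p.1].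

Record evolving_surface (vel nu : E * R -> E) : Prop := EvolvingSurface {
  es_time : 0 < T;
  es_compact : compact Gamma0;
  es_connected : connected Gamma0;
  es_smooth : smooth_surface Gamma0;
  es_oriented : oriented Gamma0;
  es_flow_smooth : smooth_on (Gamma0 `*` `[0, T]) Phi;
  es_flow_diffeo : forall t, 0 <= t <= T ->
    smooth_surface (surface_at t) /\
    diffeomorphism Gamma0 (surface_at t) (fun X => Phi (X, t));
  es_flow0 : forall X, Gamma0 X -> Phi (X, 0) = X;
  es_flow_velocity : forall X t, Gamma0 X -> 0 <= t <= T ->
    is_derive_within `[0, T] (fun s => Phi (X, s)) t (vel (Phi (X, t), t));
  es_velocity_C1 : Ck_on 1 closed_spacetime vel;
  es_normal : forall x t, closed_spacetime (x, t) ->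
    unit_outward_normal (surface_at t) x (nu (x, t))
}.

Definition is_material_derivative (f : E * R -> R) (x : E) (t d : R) : Prop :=
  exists X, [/\ Gamma0 X, Phi (X, t) = x &
    is_derive_within `[0, T] (fun s => f (Phi (X, s), s)) t d].

End EvolvingSurface.

Section Semicontinuity.
Context {R : realType} {X : topologicalType}.
Implicit Types (A : set X) (f : X -> R).

Definition lsc_on A f : Prop :=
  lower_semicontinuous ((fun x => (f x)%:E) : subspace A -> \bar R).

Definition usc_on A f : Prop := lsc_on A (fun x => - f x).

Definition locally_bounded_on A f : Prop :=
  forall x, A x -> bounded_near f (within A (nbhs x)).

Definition local_max_on A f (x : X) : Prop :=
  A x /\ \forall y \near within A (nbhs x), f y <= f x.

Definition local_min_on A f (x : X) : Prop :=
  A x /\ \forall y \near within A (nbhs x), f x <= f y.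

End Semicontinuity.

Section Viscosity.
Context {R : realType}.
Local Notation E := 'rV[R]_3.
Variables (Gamma0 : set E) (T : R) (Phi nu : E * R -> E).
Variables (H : E * R -> E -> R) (u0 : E -> R).
Local Notation Q := (closed_spacetime Gamma0 T Phi).
Local Notation Gamma := (surface_at Gamma0 Phi).

(* For phi of class C^1 on Q the material derivative d and the tangential
   gradient p both exist and are unique, so quantifying over the values d and p
   means evaluating the two operators at (x, t). *)
Definition viscosity_subsolution (u : E * R -> R) : Prop :=
  [/\ usc_on Q u,
      locally_bounded_on Q u,
      (forall x, Gamma 0 x -> u (x, 0) <= u0 x) &
      forall (phi : E * R -> R), Ck_on 1 Q phi ->
      forall x t, 0 < t -> local_max_on Q (fun q => u q - phi q) (x, t) ->
      forall d p, is_material_derivative Gamma0 T Phi phi x t d ->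
        is_tangential_gradient (Gamma t) (nu (x, t))
          (fun y => phi (y, t)) x p ->
        d + H (x, t) p <= 0].

Definition viscosity_supersolution (v : E * R -> R) : Prop :=
  [/\ lsc_on Q v,
      locally_bounded_on Q v,
      (forall x, Gamma 0 x -> u0 x <= v (x, 0)) &
      forall (phi : E * R -> R), Ck_on 1 Q phi ->
      forall x t, 0 < t -> local_min_on Q (fun q => v q - phi q) (x, t) ->
      forall d p, is_material_derivative Gamma0 T Phi phi x t d ->
        is_tangential_gradient (Gamma t) (nu (x, t))
          (fun y => phi (y, t)) x p ->
        0 <= d + H (x, t) p].

End Viscosity.

(* Main.v *)
(* Doubling of variables with the extrinsic penalty a|x - y|^2 + a^4|t - s|^2 in
   R^3.  Three facts make it work.
   - The velocity is Lipschitz on the compact space-time surface, which absorbs the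
     transport part of the material derivatives; by Gronwall it also gives
     |X - Y| <= C|Phi(X,t) - Phi(Y,t)| with C independent of t.
   - A secant of Gamma(t) is tangent up to a quadratic error, so that
     |nu(x,t).(x - y)| <= C(|x - y|^2 + |t - s|) for all points (x,t), (y,s).  Hence
     both tangential gradients are close to 2a(x - y), hence to one another, and no
     regularity of the normal field is needed.
   - The fourth power of a makes a|t - s| small at the maximum points.
   At these points the two viscosity inequalities then contradict each other because
   of the additional penalty sigma t. *)
Require Import Defs.
From HB Require Import structures.
From mathcomp Require Import all_boot all_order all_algebra.
From mathcomp Require Import all_classical all_reals all_analysis.
From mathcomp Require Import ring lra.
Import Order.TTheory GRing.Theory Num.Theory.
Import numFieldNormedType.Exports.

Local Open Scope classical_set_scope.
Local Open Scope ring_scope.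

Set Implicit Arguments.
Unset Strict Implicit.
Unset Printing Implicit Defensive.

(** * Compactness and coordinates *)

Lemma near_ball {R : realType} {V : normedModType R} (z : V) (P : V -> Prop) :
  (\forall y \near z, P y) ->
  exists2 r : R, 0 < r & forall y, `|y - z| < r -> P y.
Proof.
move=> /nbhs_ballP[r /= r0 rP]; exists r => // y yz.
by apply: rP; rewrite -ball_normE /ball_/= distrC.
Qed.

Lemma ball_near {R : realType} {V : normedModType R} (z : V) (r : R)
    (P : V -> Prop) :
  0 < r -> (forall y, `|y - z| < r -> P y) -> \forall y \near z, P y.
Proof.
move=> r0 rP; apply/nbhs_ballP; exists r => //= y.
by rewrite -ball_normE /ball_/= distrC => /rP.
Qed.

Lemma near_norm_lt {R : realType} {V : normedModType R} (z : V) (r : R) :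
  0 < r -> \forall y \near z, `|y - z| < r.
Proof. by move=> r0; apply: (ball_near r0). Qed.
Arguments near_norm_lt {R V} z {r}.

(* Lebesgue number lemma, with a constant that may grow. *)
Lemma compact_near_diagonal {R : realType} {V : normedModType R} (K : set V)
    (P : R -> V -> V -> Prop) :
  compact K ->
  (forall C C' x y, C <= C' -> P C x y -> P C' x y) ->
  (forall z, K z -> exists C r : R, 0 < r /\ forall x y, K x -> K y ->
     `|x - z| < r -> `|y - z| < r -> P C x y) ->
  exists C d : R, [/\ 0 <= C, 0 < d &
    forall x y, K x -> K y -> `|x - y| < d -> P C x y].
Proof.
move=> /compact_near_coveringP/near_covering_withinP cK Pmon Ploc.
have := cK nat \oo (fun n x => forall y, K y -> `|x - y| < n.+1%:R^-1 ->
  P n%:R x y) _.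
case=> [z Kz|n _ nP]; last first.
  by exists n%:R, n.+1%:R^-1; split => // x y Kx Ky; apply: (nP n) => //=.
have [C [r [r0 Pr]]] := Ploc z Kz.
have r20 : 0 < r / 2 by rewrite divr_gt0.
near=> x n => /= Kx y Ky xy.
have xz : `|x - z| < r / 2.
  near: x; apply: (ball_near r20) => //.
apply: (Pmon C); first by near: n; exact: nbhs_infty_ger.
have xr : `|x - z| < r by rewrite (lt_trans xz)// ltr_pdivrMr// ltr_pMr// ltr1n.
apply: Pr => //.
rewrite -(subrK x y) -addrA (le_lt_trans (ler_normD _ _))// [r]splitr.
rewrite ltrD// distrC (lt_trans xy)//.
near: n; exact: near_infty_natSinv_lt (PosNum r20).
Unshelve. all: by end_near. Qed.

(** The superlevel sets at the values of [f] are nested, so they generate a proper filter on [K]. At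
    a cluster point [x] of this filter, upper semicontinuity yields [f y < f x + e] for every [y]
    and [e]. *)
Lemma usc_has_max {R : realType} {X : topologicalType} (K : set X)
    (f : X -> R) :
  compact K -> K !=set0 ->
  (forall x, K x -> forall e, 0 < e ->
     \forall y \near within K (nbhs x), f y < f x + e) ->
  exists2 x, K x & forall y, K y -> f y <= f x.
Proof.
move=> cK K0 uscf.
pose F := filter_from K (fun y => [set x | K x /\ f y <= f x]).
have FF : ProperFilter F.
  apply: filter_from_proper; last by move=> y Ky; exists y.
  apply: filter_from_filter => // y z Ky Kz.
  have [yz|/ltW zy] := leP (f y) (f z).
    by exists z => // x [Kx zx]; split; split => //; exact: le_trans zx.
  by exists y => // x [Kx zx]; split; split => //; exact: le_trans zx.
have [|x [Kx clx]] := cK F FF.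
  by have [y Ky] := K0; exists y => // x [].
exists x => // y Ky; apply/ler_addgt0Pr => e e0.
have Fy : F [set z | K z /\ f y <= f z] by exists y.
have [w [[Kw yw] /(_ Kw) xw]] := clx _ _ Fy (uscf x Kx e e0).
by rewrite (le_trans yw)// ltW.
Qed.

(** Serves R^n and space-time R^3 x R alike, so that each Taylor estimate is proved once. The bound
    on [c i v] has constant 1 because both norms are sup norms. *)
Definition coordinates {R : realType} {V : normedModType R} {n : nat}
    (e : 'I_n -> V) (c : 'I_n -> V -> R) : Prop :=
  (forall v, v = \sum_i c i v *: e i) /\ forall i v, `|c i v| <= `|v|.

Lemma coord_le_norm {R : realType} {n : nat} (v : 'rV[R]_n) i :
  `|v 0 i| <= `|v|.
Proof.
rewrite {2}/Num.norm/= mx_normrE.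
by apply: le_trans (le_bigmax _ _ (0, i)).
Qed.

Lemma norm_le_coord {R : realType} {n : nat} (v : 'rV[R]_n) (M : R) :
  0 <= M -> (forall i, `|v 0 i| <= M) -> `|v| <= M.
Proof.
move=> M0 vM; rewrite {1}/Num.norm/= mx_normrE.
by apply/bigmax_leP; split => // -[i j] _ /=; rewrite ord1.
Qed.

Lemma coordinates_rV {R : realType} {n : nat} :
  @coordinates R 'rV[R]_n n (delta_mx 0) (fun i v => v 0 i).
Proof. by split => [v|i v]; [exact: row_sum_delta | exact: coord_le_norm]. Qed.

(** Index [ord0] is the time direction; the others are the space directions. *)
Lemma coordinates_rVR {R : realType} {n : nat} :
  @coordinates R ('rV[R]_n * R)%type n.+1
    (fun i => if unlift ord0 i is Some j then (delta_mx 0 j, 0) else (0, 1))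
    (fun i v => if unlift ord0 i is Some j then v.1 0 j else v.2).
Proof.
split => [v|i v].
  rewrite big_ord_recl unlift_none.
  under eq_bigr do rewrite liftK.
  apply: injective_projections => /=.
    rewrite raddf_sum /= scaler0 add0r; exact: row_sum_delta.
  rewrite raddf_sum /= big1 => [|i _]; last by rewrite scaler0.
  by rewrite addr0 [_ *: _]mulr1.
case: unliftP => [j _|_]; rewrite prod_normE le_max.
  by rewrite coord_le_norm.
by rewrite lexx orbT.
Qed.

(** * Taylor estimates for C^1 and C^2 maps *)

Lemma is_derive_coord {R : realType} {V : normedModType R} {m : nat}
    (g : V -> 'rV[R]_m) (x v : V) w j :
  is_derive x v g w -> is_derive x v (fun y => g y 0 j) (w 0 j).
Proof.
move=> [dg <-].
have cg : h^-1 *: (g (h *: v + x) 0 j - g x 0 j) @[h --> 0^'] --> 'D_v g x 0 j.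
  have := cvg_comp _ _ dg (@coord_continuous R 1 m 0 j _).
  apply: cvg_trans; apply: near_eq_cvg; near=> h => /=.
  by rewrite !mxE.
apply: DeriveDef; first by apply/cvg_ex; exists ('D_v g x 0 j).
exact: cvg_lim cg.
Unshelve. all: by end_near. Qed.

Section Calculus.
Context {R : realType} {V : normedModType R}.

Lemma is_derive_on_line {W : normedModType R} (g : V -> W) (y v : V) (t : R) :
  differentiable g (y + t *: v) ->
  is_derive t 1 (fun s : R => g (y + s *: v)) ('D_v g (y + t *: v)).
Proof.
move=> dg.
have cg : h^-1 *: (g (y + (h *: 1 + t) *: v) - g (y + t *: v))
    @[h --> 0^'] --> 'D_v g (y + t *: v).
  have := diff_derivable (v := v) dg.
  apply: cvg_trans; apply: near_eq_cvg; near=> h => /=.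
  by congr (_ *: (g _ - _)); rewrite [h *: 1]mulr1 scalerDl addrCA.
apply: DeriveDef; first by apply/cvg_ex; exists ('D_v g (y + t *: v)).
exact: cvg_lim cg.
Unshelve. all: by end_near. Qed.

(** The mean value theorem fails for vector-valued maps, so it is applied to coordinate [j] alone
    along the segment, with an intermediate point depending on [j]. *)
Lemma segment_mvt {m : nat} (g : V -> 'rV[R]_m) (y w : V) j :
  (forall t : R, 0 <= t <= 1 -> differentiable g (y + t *: (w - y))) ->
  exists2 t : R, 0 <= t <= 1 &
    (g w - g y) 0 j = 'D_(w - y) g (y + t *: (w - y)) 0 j.
Proof.
move=> dg.
have dgl (t : R) : 0 <= t <= 1 -> is_derive t 1
    (fun s : R => g (y + s *: (w - y)) 0 j) ('D_(w - y) g (y + t *: (w - y)) 0 j).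
  by move=> t01; apply/is_derive_coord/is_derive_on_line/dg.
have dgo (t : R) : t \in `]0, 1[%R -> is_derive t 1
    (fun s : R => g (y + s *: (w - y)) 0 j) ('D_(w - y) g (y + t *: (w - y)) 0 j).
  by rewrite in_itv/= => /andP[t0 t1]; apply: dgl; rewrite !ltW.
have gc : {within `[0, 1], continuous (fun s : R => g (y + s *: (w - y)) 0 j)}.
  apply: derivable_within_continuous => t; rewrite in_itv/= => t01.
  exact: (@ex_derive _ _ _ _ _ _ _ (dgl _ t01)).
have [t] := MVT_segment ler01 dgo gc.
rewrite in_itv/= => t01 tE; exists t => //.
by move: tE; rewrite scale1r scale0r addr0 subrKC subr0 mulr1 !mxE.
Qed.

Lemma segment_ball (z y w : V) (r t : R) :
  `|y - z| < r -> `|w - z| < r -> 0 <= t <= 1 -> `|y + t *: (w - y) - z| < r.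
Proof.
move=> yr wr /andP[t0 t1].
have -> : y + t *: (w - y) - z = (1 - t) *: (y - z) + t *: (w - z).
  have -> : w - y = (w - z) - (y - z) by rewrite opprB addrA subrK.
  by rewrite addrAC scalerBr scalerBl scale1r addrA addrAC.
rewrite (le_lt_trans (ler_normD _ _))// !normrZ !ger0_norm ?subr_ge0//.
have [->|tn0] := eqVneq t 0; first by rewrite subr0 mul1r mul0r addr0.
have t0' : 0 < t by rewrite lt_def tn0.
have : t * `|w - z| < t * r by rewrite ltr_pM2l.
have : (1 - t) * `|y - z| <= (1 - t) * r by rewrite ler_wpM2l ?subr_ge0// ltW.
lra.
Qed.

Lemma derive_coordinates {W : normedModType R} {n : nat} (e : 'I_n -> V)
    (c : 'I_n -> V -> R) (g : V -> W) (y v : V) :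
  coordinates e c -> differentiable g y ->
  'D_v g y = \sum_i c i v *: 'D_(e i) g y.
Proof.
move=> [ec _] dg; rewrite deriveE// {1}(ec v) linear_sum.
by apply: eq_bigr => i _; rewrite linearZ deriveE.
Qed.

Lemma C1_derive_bounded {W : normedModType R} {n : nat} (e : 'I_n -> V)
    (c : 'I_n -> V -> R) (U : set V) (g : V -> W) (z : V) :
  coordinates e c -> open_nbhs z U -> is_Ck 1 U g ->
  exists C r : R, [/\ 0 <= C, 0 < r & forall y, `|y - z| < r ->
    [/\ U y, differentiable g y & forall v, `|'D_v g y| <= C * `|v|]].
Proof.
move=> ec zU [dg cg].
(* On a ball, continuity at [z] keeps each of the finitely many partial derivatives below its norm
   at [z] plus 1. *)
pose C := \sum_(i < n) (`|'D_(e i) g z| + 1).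
have : \forall y \near z, forall i, `|'D_(e i) g y| < `|'D_(e i) g z| + 1.
  apply: filter_forall => i.
  have /cvg_norm := cg (e i) _ (nbhs_singleton (open_nbhs_nbhs zU)).
  by move=> /cvgr_lt; apply; rewrite ltrDl.
move=> H; have [r r0 rP] := near_ball (filterI (open_nbhs_nbhs zU) H).
exists C, r; split => //.
  by apply: sumr_ge0 => i _; rewrite addr_ge0.
move=> y /rP[Uy yP]; split => // [|v]; first exact: dg.
rewrite (derive_coordinates _ ec); last exact: dg.
rewrite mulr_suml (le_trans (ler_norm_sum _ _ _))//; apply: ler_sum => i _.
by rewrite normrZ mulrC ler_pM// ?(ec.2)// ltW.
Qed.

Lemma C1_lipschitz {m n : nat} (e : 'I_n -> V)
    (c : 'I_n -> V -> R) (U : set V) (g : V -> 'rV[R]_m) (z : V) :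
  coordinates e c -> open_nbhs z U -> is_Ck 1 U g ->
  exists C r : R, [/\ 0 <= C, 0 < r & forall y w, `|y - z| < r -> `|w - z| < r ->
    `|g w - g y| <= C * `|w - y|].
Proof.
move=> ec zU C1g; have [C [r [C0 r0 gP]]] := C1_derive_bounded ec zU C1g.
exists C, r; split => // y w yr wr; apply: norm_le_coord => [|j].
  by rewrite mulr_ge0.
have [t t01|t t01 ->] := @segment_mvt m g y w j.
  by have [] := gP _ (segment_ball yr wr t01).
rewrite (le_trans (coord_le_norm _ _))//.
by have [_ _] := gP _ (segment_ball yr wr t01); apply.
Qed.

(** The mean value theorem leaves the difference of the first derivatives at [y] and at a point of
    the segment. The derivative in each basis direction is C^1, hence Lipschitz near [z], so this
    difference supplies a second factor |w - y|. *)
Lemma C2_taylor {m n : nat} (e : 'I_n -> V)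
    (c : 'I_n -> V -> R) (U : set V) (g : V -> 'rV[R]_m) (z : V) :
  coordinates e c -> open_nbhs z U -> is_Ck 2 U g ->
  exists C r : R, [/\ 0 <= C, 0 < r & forall y w, `|y - z| < r -> `|w - z| < r ->
    `|g w - g y - 'D_(w - y) g y| <= C * `|w - y| ^+ 2].
Proof.
move=> ec zU [dg C1g].
have Dlip i := C1_lipschitz ec zU (C1g (e i)).
pose C i := projT1 (cid (Dlip i)).
pose r i := projT1 (cid (projT2 (cid (Dlip i)))).
have CrP i : [/\ 0 <= C i, 0 < r i & forall y w, `|y - z| < r i ->
    `|w - z| < r i -> `|'D_(e i) g w - 'D_(e i) g y| <= C i * `|w - y|].
  exact: (projT2 (cid (projT2 (cid (Dlip i))))).
have [|d d0 dP] := @near_ball _ _ z (fun y => U y /\ forall i, `|y - z| < r i).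
  apply: filterI; first exact: open_nbhs_nbhs.
  apply: filter_forall => i; have [_ ri _] := CrP i.
  exact: (near_norm_lt z ri).
exists (\sum_i C i), d; split => //.
  by apply: sumr_ge0 => i _; have [] := CrP i.
move=> y w yd wd; apply: norm_le_coord => [|j].
  by rewrite mulr_ge0 ?sqr_ge0//; apply: sumr_ge0 => i _; have [] := CrP i.
have [t t01|t t01] := @segment_mvt m g y w j.
  by apply: dg; have [] := dP _ (segment_ball yd wd t01).
have xd := segment_ball yd wd t01.
set x := y + _ in xd *; rewrite !mxE => ->.
have -> : forall a b : 'rV[R]_m, a 0 j - b 0 j = (a - b) 0 j by move=> a b; rewrite !mxE.
rewrite (le_trans (coord_le_norm _ _))//.
have [Ux xr] := dP _ xd; have [Uy yr] := dP _ yd.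
rewrite !(derive_coordinates _ ec); [|exact: dg..].
rewrite -sumrB mulr_suml (le_trans (ler_norm_sum _ _ _))//.
apply: ler_sum => i _; have [C0 _ /(_ _ _ (yr i) (xr i)) H] := CrP i.
rewrite -scalerBr normrZ (le_trans (ler_pM _ _ (ec.2 i _) H))//.
rewrite mulrCA ler_wpM2l// expr2 ler_wpM2l// /x addrC addKr normrZ.
by move: t01 => /andP[t0 t1]; rewrite ger0_norm// ler_piMl.
Qed.

End Calculus.

(** * Lipschitz bounds and secants of a surface *)

Section Euclid.
Context {R : realType} {n : nat}.
Implicit Types a b c : 'rV[R]_n.

Lemma dotC a b : dot a b = dot b a.
Proof. by apply: eq_bigr => i _; rewrite mulrC. Qed.

Lemma dotDr a b c : dot a (b + c) = dot a b + dot a c.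
Proof. by rewrite -big_split; apply: eq_bigr => i _ /=; rewrite mxE mulrDr. Qed.

Lemma dotNr a b : dot a (- b) = - dot a b.
Proof. by rewrite -sumrN; apply: eq_bigr => i _ /=; rewrite mxE mulrN. Qed.

Lemma dotBr a b c : dot a (b - c) = dot a b - dot a c.
Proof. by rewrite dotDr dotNr. Qed.

Lemma dotZr k a b : dot a (k *: b) = k * dot a b.
Proof. by rewrite mulr_sumr; apply: eq_bigr => i _ /=; rewrite mxE mulrCA. Qed.

Lemma dot_sqrD a b : dot (a + b) (a + b) = dot a a + 2 * dot a b + dot b b.
Proof. by rewrite !dotDr !(dotC (a + b)) !dotDr (dotC b a); ring. Qed.

Lemma dot_ge0 a : 0 <= dot a a.
Proof. by apply: sumr_ge0 => i _; rewrite -expr2 sqr_ge0. Qed.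

Lemma norm_dot_le a b : `|dot a b| <= n%:R * (`|a| * `|b|).
Proof.
rewrite (le_trans (ler_norm_sum _ _ _))//.
rewrite mulr_natl -[X in _ *+ X]card_ord -sumr_const ler_sum// => i _.
by rewrite normrM ler_pM// coord_le_norm.
Qed.

Lemma norm_le_enorm a : `|a| <= enorm a.
Proof.
apply: norm_le_coord => [|i]; first exact: sqrtr_ge0.
rewrite -sqrtr_sqr ler_wsqrtr// /dot (bigD1 i)//= -expr2 lerDl.
by apply: sumr_ge0 => j _; rewrite -expr2 sqr_ge0.
Qed.

Lemma sqr_norm_le_dot a : `|a| ^+ 2 <= dot a a.
Proof.
by rewrite -(sqr_sqrtr (dot_ge0 a)) ler_sqr ?nnegrE// ?sqrtr_ge0// norm_le_enorm.
Qed.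

Lemma dot_le_sqr_norm a : dot a a <= n%:R * `|a| ^+ 2.
Proof. by rewrite expr2 (le_trans (ler_norm _))// norm_dot_le. Qed.

Lemma enorm_le_norm a : enorm a <= n%:R * `|a|.
Proof.
rewrite -[leRHS]ger0_norm ?mulr_ge0// -sqrtr_sqr ler_wsqrtr//.
rewrite (le_trans (dot_le_sqr_norm a))// exprMn ler_wpM2r ?sqr_ge0//.
have sq k : (k <= k ^ 2)%N by case: k => // k; rewrite leq_pmull.
by rewrite -natrX ler_nat.
Qed.

End Euclid.

Lemma smooth_Ck_on {R : realType} {V W : normedModType R} (A : set V)
    (f : V -> W) k : smooth_on A f -> Ck_on k A f.
Proof. by move=> sf x /sf[U [g [? gk]]]; exists U, g. Qed.

(** Close pairs are handled by local Lipschitz bounds and the Lebesgue number [d]. For |x - y| >= d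
    a bound [B] on [f] suffices, as 2B <= (2B/d)|x - y|. *)
Lemma compact_lipschitz {R : realType} {V : normedModType R} {m n : nat}
    (e : 'I_n -> V) (c : 'I_n -> V -> R) (K : set V) (f : V -> 'rV[R]_m) :
  coordinates e c -> compact K -> Ck_on 1 K f ->
  exists2 L : R, 0 <= L & forall x y, K x -> K y -> `|f x - f y| <= L * `|x - y|.
Proof.
move=> ec cK C1f.
have floc z : K z -> exists C r : R, [/\ 0 <= C, 0 < r &
    forall y w, K y -> K w -> `|y - z| < r -> `|w - z| < r ->
    `|f y - f w| <= C * `|y - w|].
  move=> Kz; have [U [g [[zU gf] C1g]]] := C1f z Kz.
  have [C [r [C0 r0 gP]]] := C1_lipschitz ec zU C1g.
  have [|s s0 sP] := @near_ball _ _ z (fun y => U y /\ `|y - z| < r).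
    by apply: filterI; [exact: open_nbhs_nbhs | exact: (ball_near r0 (fun _ h => h))].
  exists C, s; split => // y w Ky Kw /sP[Uy yr] /sP[Uw wr].
  by rewrite -!gf// gP.
have [C [d [C0 d0 fC]]] : exists C d : R, [/\ 0 <= C, 0 < d &
    forall y w, K y -> K w -> `|y - w| < d -> `|f y - f w| <= C * `|y - w|].
  apply: (@compact_near_diagonal _ _ K
      (fun C y w => `|f y - f w| <= C * `|y - w|)) => //.
    by move=> C C' x y CC' /le_trans; apply; rewrite ler_wpM2r.
  by move=> z /floc[C [r [C0 r0 H]]]; exists C, r; split => // *; exact: H.
(* Boundedness of [f] comes from the same covering lemma, used afterwards only for pairs of equal
   points. *)
have [B [d' [B0 d'0 fB]]] : exists B d : R, [/\ 0 <= B, 0 < d &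
    forall y w, K y -> K w -> `|y - w| < d -> `|f y| <= B].
  apply: (@compact_near_diagonal _ _ K (fun B y w => `|f y| <= B)) => //.
    by move=> B B' x y BB' /le_trans; apply.
  move=> z Kz; have [C' [r [C'0 r0 H]]] := floc z Kz.
  exists (`|f z| + C' * r), r; split => // x y Kx Ky xz _.
  rewrite -[f x](subrK (f z)) addrC (le_trans (ler_normD _ _))// lerD2l.
  by rewrite (le_trans (H _ _ Kx Kz xz _))// ?subrr ?normr0// ler_wpM2l// ltW.
exists (C + 2 * B / d); first by rewrite addr_ge0// divr_ge0 ?mulr_ge0// ltW.
move=> x y Kx Ky; rewrite mulrDl; have [/fC|dxy] := ltP `|x - y| d.
  move=> /(_ Kx Ky) /le_trans; apply; rewrite lerDl mulr_ge0//.
  by rewrite divr_ge0 ?mulr_ge0// ltW.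
have fK z : K z -> `|f z| <= B by move=> Kz; apply: (fB z z); rewrite ?subrr ?normr0.
rewrite (le_trans (ler_normB _ _))//.
apply: (@le_trans _ _ (2 * B)); first by have := fK _ Kx; have := fK _ Ky; lra.
rewrite -[leLHS]addr0 addrC lerD ?mulr_ge0// mulrAC ler_pdivlMr//.
by rewrite ler_wpM2l ?mulr_ge0.
Qed.

Lemma lipschitz_within_continuous {R : realType} {V W : normedModType R}
    (K : set V) (f : V -> W) (L : R) :
  0 <= L -> (forall x y, K x -> K y -> `|f x - f y| <= L * `|x - y|) ->
  {within K, continuous f}.
Proof.
move=> L0 fL; apply/subspace_continuousP => x Kx.
apply/cvgrPdist_lt => e e0; apply/(@ball_near _ _ _ (e / (L + 1))).
  by rewrite divr_gt0// ltr_pwDr.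
move=> y xy Ky; rewrite (le_lt_trans (fL _ _ Kx Ky))// distrC.
rewrite (@le_lt_trans _ _ ((L + 1) * `|y - x|)) ?ler_wpM2r ?lerDl//.
by rewrite mulrC -ltr_pdivlMr// ltr_pwDr.
Qed.

(* In a chart [psi], the tangent vector is [D psi a (b - a)] where X = psi a and
   Y = psi b. *)
Lemma surface_secant {R : realType} (M : set 'rV[R]_3) (X0 : 'rV[R]_3) :
  smooth_surface M -> M X0 ->
  exists C r : R, [/\ 0 <= C, 0 < r & forall X Y, M X -> M Y ->
    `|X - X0| < r -> `|Y - X0| < r -> exists w, tangent_vector M X w /\
    `|Y - X - w| <= C * `|Y - X| ^+ 2].
Proof.
move=> sM MX0; have [Ob [U [psi [X0O oU [sp pU [g sg gp]]]]]] := sM _ MX0.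
have [a0 Ua0 pa0] : (psi @` U) X0.
  by rewrite pU; split => //; exact: nbhs_singleton (open_nbhs_nbhs X0O).
have MOX0 : (M `&` Ob) X0 by rewrite -pU; exists a0.
(* The inverse chart enters through its Lipschitz bound, which turns |b - a|^2 into |Y - X|^2; the
   chart itself is expanded to second order. *)
have [V1 [g1 [[X0V gg1] /(_ 1%N) Cg1]]] := sg _ MOX0.
have [U1 [p1 [[aU pp1] /(_ 2%N) Cp1]]] := sp _ Ua0.
have [C1 [r1 [C10 r10 g1P]]] := C1_lipschitz coordinates_rV X0V Cg1.
have [C2 [r2 [C20 r20 p1P]]] := C2_taylor coordinates_rV aU Cp1.
have V1X0 : V1 X0 := nbhs_singleton (open_nbhs_nbhs X0V).
have g1X0 : g1 X0 = a0.
  by rewrite (gg1 _ MOX0 V1X0) -pa0 (gp _ Ua0).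
have cg1 : {for X0, continuous g1}.
  by apply: differentiable_continuous; exact: Cg1.1.
have na0 : \forall a \near a0, U1 a /\ `|a - a0| < r2.
  by apply: filterI; [exact: open_nbhs_nbhs | exact: (near_norm_lt a0 r20)].
have nX0 : \forall X \near X0, [/\ Ob X, V1 X, `|X - X0| < r1, U1 (g1 X) &
    `|g1 X - a0| < r2].
  have h1 : \forall X \near X0, U1 (g1 X) /\ `|g1 X - a0| < r2.
    have g1a0 : g1 X @[X --> X0] --> a0 by rewrite -g1X0.
    exact: (g1a0 _ na0).
  have h2 : \forall X \near X0, `|X - X0| < r1 by exact: (near_norm_lt X0 r10).
  have h3 := open_nbhs_nbhs X0V; have h4 := open_nbhs_nbhs X0O.
  near=> X; have h : U1 (g1 X) /\ `|g1 X - a0| < r2 by near: X.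
  by case: h => ? ?; split => //; near: X.
have [r r0 rP] := near_ball nX0.
exists (C2 * C1 ^+ 2), r; split; rewrite ?mulr_ge0 ?sqr_ge0//.
have coordX X : M X -> `|X - X0| < r -> [/\ U (g1 X), U1 (g1 X),
    psi (g1 X) = X, `|g1 X - a0| < r2 & `|X - X0| < r1].
  move=> MX /rP[OX VX Xr UgX gXr].
  have MOX : (M `&` Ob) X by [].
  have [a Ua paX] : (psi @` U) X by rewrite pU.
  have ga : g1 X = a by rewrite gg1// -paX gp.
  by rewrite ga paX; split => //; rewrite -ga.
move=> X Y MX MY /(coordX _ MX)[Ua U1a pa ar Xr1] /(coordX _ MY)[Ub U1b pb br Yr1].
set a := g1 X in Ua U1a pa ar; set b := g1 Y in Ub U1b pb br.
have p1a : p1 a = X by rewrite pp1.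
have p1b : p1 b = Y by rewrite pp1.
exists ('D_(b - a) p1 a); split; last first.
  have := p1P _ _ ar br; rewrite p1a p1b => /le_trans; apply.
  rewrite -mulrA ler_wpM2l// -exprMn lerXn2r ?nnegrE ?mulr_ge0//.
  exact: g1P.
(* The witness curve is the chart image of the line through [a] and [b]; it lies in [M] for small
   [s] because [U] is open. *)
exists (fun s => p1 (a + s *: (b - a))); split.
- by rewrite scale0r addr0.
- have la : a + s *: (b - a) @[s --> (0 : R)] --> a.
    have : a + s *: (b - a) @[s --> (0 : R)] --> a + 0 *: (b - a).
      by apply: cvgD; [exact: cvg_cst | apply: cvgZr_tmp; exact: cvg_id].
    by rewrite scale0r addr0.
  have oU1 : open U1 by case: aU.
  have nU : \forall s \near (0 : R), (U `&` U1) (a + s *: (b - a)).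
    by apply: la; apply: filterI; apply: open_nbhs_nbhs.
  apply: filterS nU => s [Us U1s]; rewrite pp1//.
  have : (psi @` U) (psi (a + s *: (b - a))) by exists (a + s *: (b - a)).
  by rewrite pU => -[].
- have := @is_derive_on_line _ _ _ p1 a (b - a) 0.
  by rewrite scale0r addr0; apply; exact: Cp1.1.
Unshelve. all: by end_near. Qed.

(** * One-sided derivatives *)

Lemma cvg_dot {R : realType} {n : nat} {X : Type} (F : set_system X)
    (FF : Filter F) (f g : X -> 'rV[R]_n) (a b : 'rV[R]_n) :
  f x @[x --> F] --> a -> g x @[x --> F] --> b ->
  dot (f x) (g x) @[x --> F] --> dot a b.
Proof.
move=> fa gb; rewrite /dot; elim: (index_enum _) => [|i s IH].
  rewrite big_nil; under eq_fun do rewrite big_nil; exact: cvg_cst.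
rewrite big_cons; under eq_fun do rewrite big_cons.
apply: cvgD IH; apply: cvgM.
  exact: cvg_comp _ _ fa (@coord_continuous R 1 n 0 i _).
exact: cvg_comp _ _ gb (@coord_continuous R 1 n 0 i _).
Qed.

Section DeriveWithin.
Context {R : realType}.
Implicit Types (I : set R) (t : R).

Lemma within_dnbhs_neq I t : \forall s \near within I t^', s != t.
Proof.
by change (nbhs t (fun s => s != t -> I s -> s != t)); exact: (@nearW _ (nbhs t)).
Qed.

Lemma is_derive_within_cvg {W : normedModType R} I (f : R -> W) t d :
  is_derive_within I f t d -> f s @[s --> within I t^'] --> f t.
Proof.
move=> fd.
have st : (s - t) @[s --> within I t^'] --> (0 : R).
  have st : (s - t) @[s --> t] --> (0 : R).
    by rewrite -[X in _ --> X](subrr t); apply: cvgB; [exact: cvg_id | exact: cvg_cst].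
  move=> A /st stA.
  change (nbhs t (fun s => s != t -> I s -> A (s - t))).
  by near=> s => _ _; near: s.
have : (s - t) *: ((s - t)^-1 *: (f s - f t)) + f t @[s --> within I t^']
    --> 0 *: d + f t.
  by apply: cvgD; [exact: cvgZ | exact: cvg_cst].
rewrite scale0r add0r; apply: cvg_trans; apply: near_eq_cvg.
near=> s => /=.
rewrite scalerA divff ?scale1r ?subrK// subr_eq0.
by near: s; exact: within_dnbhs_neq.
Unshelve. all: by end_near. Qed.

Lemma is_derive_within_dot {n : nat} I (f g : R -> 'rV[R]_n) t df dg :
  is_derive_within I f t df -> is_derive_within I g t dg ->
  is_derive_within I (fun s => dot (f s) (g s)) t
    (dot (f t) dg + dot (g t) df).
Proof.
move=> fd gd; have ft := is_derive_within_cvg fd.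
have : dot (f s) ((s - t)^-1 *: (g s - g t)) +
    dot (g t) ((s - t)^-1 *: (f s - f t)) @[s --> within I t^']
    --> dot (f t) dg + dot (g t) df.
  by apply: cvgD; apply: cvg_dot => //; exact: cvg_cst.
apply: cvg_trans; apply: near_eq_cvg; apply: nearW => s /=.
rewrite !dotZr -mulrDr; congr (_ * _); rewrite !dotBr (dotC (f s) (g t)).
by rewrite (dotC (g t) (f t)) addrA subrK.
Qed.

Lemma is_derive_withinD {W : normedModType R} I (f g : R -> W) t df dg :
  is_derive_within I f t df -> is_derive_within I g t dg ->
  is_derive_within I (fun s => f s + g s) t (df + dg).
Proof.
move=> fd gd; apply: cvg_trans (cvgD fd gd); apply: near_eq_cvg.
by apply: nearW => s /=; rewrite fctE -scalerDr opprD addrACA.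
Qed.

Lemma is_derive_withinZ {W : normedModType R} I (f : R -> W) t df (k : R) :
  is_derive_within I f t df -> is_derive_within I (fun s => k *: f s) t (k *: df).
Proof.
move=> fd; apply: cvg_trans (cvgZ (cvg_cst k) fd); apply: near_eq_cvg.
by apply: nearW => s /=; rewrite -scalerBr !scalerA mulrC.
Qed.

Lemma is_derive_within_cst {W : normedModType R} I (a : W) t :
  is_derive_within I (fun=> a) t 0.
Proof.
rewrite /is_derive_within; under eq_fun do rewrite subrr scaler0.
exact: cvg_cst.
Qed.

Lemma is_derive_withinB {W : normedModType R} I (f g : R -> W) t df dg :
  is_derive_within I f t df -> is_derive_within I g t dg ->
  is_derive_within I (fun s => f s - g s) t (df - dg).
Proof.
move=> fd gd; have := is_derive_withinD fd (is_derive_withinZ (k := -1) gd).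
by rewrite scaleN1r; under eq_fun do rewrite scaleN1r.
Qed.

Lemma is_derive_within_id I t : is_derive_within I (fun s : R => s : R^o) t 1.
Proof.
have : (1 : R^o) @[s --> within I t^'] --> (1 : R^o) by exact: cvg_cst.
apply: cvg_trans; apply: near_eq_cvg.
near=> s => /=.
rewrite [_ *: _]mulVf// subr_eq0; near: s; exact: within_dnbhs_neq.
Unshelve. all: by end_near. Qed.

(** The flow is differentiable in time only relative to [0, T]. At interior times this becomes an
    ordinary derivative, as the monotonicity test in [flow_expanding] requires. *)
Lemma is_derive_within_oo {W : normedModType R} (a b : R) (f : R -> W) t d :
  a < t < b -> is_derive_within `[a, b] f t d -> is_derive t 1 f d.
Proof.
move=> /andP[ta tb] /cvgrPdist_lt fd.
have cf : h^-1 *: (f (h *: 1 + t) - f t) @[h --> 0^'] --> d.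
  apply/cvgrPdist_lt => e e0; have [r r0 rP] := near_ball (fd e e0).
  have r'0 : 0 < Num.min r (Num.min (t - a) (b - t)).
    by rewrite !lt_min r0 !subr_gt0 ta tb.
  near=> h.
  have h0 : h != 0 by near: h; exact: nbhs_dnbhs_neq.
  have : `|h - 0| < Num.min r (Num.min (t - a) (b - t)).
    by near: h; apply: nbhs_dnbhs; exact: (near_norm_lt (0 : R) r'0).
  rewrite subr0 !lt_min => /and3P[hr ha hb].
  rewrite [h *: 1]mulr1; have := rP (h + t); rewrite addrK; apply => //.
    by apply: contra_neq h0 => /(canRL (addrK _)); rewrite subrr.
  rewrite /= in_itv/=; move: ha hb; rewrite !ltr_norml; lra.
apply: DeriveDef; first by apply/cvg_ex; exists d.
exact: cvg_lim cf.
Unshelve. all: by end_near. Qed.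

End DeriveWithin.

(** * Geometry of the evolving surface *)

(** The flow at time [t] maps a curve in [Gamma0] to a curve in Gamma(t), and the chain rule gives
    its velocity. The extension [g] is differentiated because [Phi] is controlled only on [Gamma0] x
    [0, T]. *)
Lemma tangent_push {R : realType} (Gamma0 : set 'rV[R]_3) (T : R)
    (Phi g : 'rV[R]_3 * R -> 'rV[R]_3) (U : set ('rV[R]_3 * R))
    (X w : 'rV[R]_3) (t : R) :
  open U -> U (X, t) -> differentiable g (X, t) ->
  (forall z, (Gamma0 `*` `[0, T]) z -> U z -> g z = Phi z) ->
  0 <= t <= T -> Gamma0 X -> tangent_vector Gamma0 X w ->
  tangent_vector (surface_at Gamma0 Phi t) (Phi (X, t)) ('D_((w, 0)) g (X, t)).
Proof.
move=> oU UX dg gP tT GX [gam [gam0 Mgam [dgam gamw]]].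
have dgam1 : differentiable gam 0 by exact/derivable1_diffP.
have gamdiff : is_diff (0 : R) gam ('d gam 0) by exact: DiffDef.
pose p s : 'rV[R]_3 * R := (gam s, t).
have pdiff : is_diff (0 : R) p (fun v => ('d gam 0 v, 0)).
  exact: (is_diff_pair gamdiff (is_diff_cst t (0 : R))).
have dp : differentiable p 0 by case: pdiff.
have dpE : 'd p 0 = (fun v => ('d gam 0 v, 0)) :> (R -> _) by exact: diff_val.
have p0 : p 0 = (X, t) by rewrite /p gam0.
have pc : {for 0, continuous p} by apply: differentiable_continuous.
exists (fun s => Phi (gam s, t)); split.
- by rewrite gam0.
- by near=> s; exists (gam s) => //; near: s.
- apply: (@near_eq_is_derive _ _ _ (g \o p)).
    have pU : \forall s \near (0 : R), U (p s).
      by apply: (pc U); rewrite p0; apply: open_nbhs_nbhs.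
    near=> s; apply: gP; last by near: s.
    by split => /=; [near: s | rewrite in_itv].
  have dgp : differentiable g (p 0) by rewrite p0.
  apply: DeriveDef; first by apply: diff_derivable; exact: differentiable_comp.
  have dgamE : 'd gam 0 1 = w by rewrite -gamw deriveE.
  rewrite deriveE; last exact: differentiable_comp.
  rewrite (diff_comp dp dgp) [LHS]/comp dpE dgamE p0.
  by rewrite -(deriveE (w, 0) dg).
Unshelve. all: by end_near. Qed.

Section EvolvingSurfaceGeometry.
Context {R : realType}.
Variables (Gamma0 : set 'rV[R]_3) (T : R).
Variables (Phi vel nu : 'rV[R]_3 * R -> 'rV[R]_3).
Hypothesis Hes : evolving_surface Gamma0 T Phi vel nu.
Local Notation Q := (closed_spacetime Gamma0 T Phi).
Local Notation K := (Gamma0 `*` `[0, T]).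

Lemma flow_closed_spacetime X t :
  Gamma0 X -> 0 <= t <= T -> Q (Phi (X, t), t).
Proof. by move=> GX tT; split => //; exists X. Qed.

Lemma flow_domain_compact : compact K.
Proof. by apply: compact_setX; [exact: es_compact Hes | exact: segment_compact]. Qed.

Lemma flow_lipschitz : exists2 L : R, 0 <= L & forall z w, K z -> K w ->
  `|Phi z - Phi w| <= L * `|z - w|.
Proof.
apply: (compact_lipschitz coordinates_rVR) => //; first exact: flow_domain_compact.
exact/smooth_Ck_on/(es_flow_smooth Hes).
Qed.

Lemma closed_spacetime_compact : compact Q.
Proof.
have [L L0 PhiL] := flow_lipschitz.
(* The space-time surface is the image of a compact cylinder under a Lipschitz map. *)
have -> : Q = (fun z => (Phi z, z.2)) @` K.
  apply/seteqP; split => [[x t] [/= tT [X GX Xx]]|_ [[X t] [/= GX tT] <-]].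
    by exists (X, t); rewrite /= ?Xx.
  by apply: flow_closed_spacetime => //; rewrite in_itv/= in tT.
apply: continuous_compact; last exact: flow_domain_compact.
apply: (@lipschitz_within_continuous _ _ _ _ _ (L + 1)); first by rewrite addr_ge0.
move=> z w Kz Kw; rewrite prod_normE/= ge_max; apply/andP; split.
  by rewrite (le_trans (PhiL _ _ Kz Kw))// ler_wpM2r// lerDl.
rewrite (@le_trans _ _ `|z - w|)//; first by rewrite prod_normE le_max lexx orbT.
by rewrite ler_peMl// lerDr.
Qed.

Lemma vel_lipschitz : exists2 L : R, 0 <= L & forall z w, Q z -> Q w ->
  `|vel z - vel w| <= L * `|z - w|.
Proof.
apply: (compact_lipschitz coordinates_rVR); first exact: closed_spacetime_compact.
exact: es_velocity_C1 Hes.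
Qed.

(* Gronwall backwards: along the flow |Phi(X,t) - Phi(Y,t)|^2 e^(6Lt) is
   nondecreasing, and Phi(.,0) is the identity. *)
Lemma flow_expanding : exists2 C : R, 0 <= C & forall X Y t,
  Gamma0 X -> Gamma0 Y -> 0 <= t <= T ->
  `|X - Y| <= C * `|Phi (X, t) - Phi (Y, t)|.
Proof.
have [LP LP0 PhiL] := flow_lipschitz.
have [L L0 velL] := vel_lipschitz.
have T0 : 0 < T := es_time Hes.
(* The rate 6L is twice the factor 3 lost in [norm_dot_le], times the Lipschitz constant of the
   velocity. The last factor 3 passes from the Euclidean square back to the sup norm in R^3. *)
exists (Num.sqrt (expR (6 * L * T) * 3)); first exact: sqrtr_ge0.
move=> X Y t GX GY /andP[t0 tT].
pose D s := Phi (X, s) - Phi (Y, s).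
pose D' s := vel (Phi (X, s), s) - vel (Phi (Y, s), s).
pose f s := expR (6 * L * s) * dot (D s) (D s).
have dD s : 0 <= s <= T -> is_derive_within `[0, T] D s (D' s).
  by move=> sT; apply: is_derive_withinB; exact: es_flow_velocity Hes _ _ _ sT.
have df s : s \in `]0, T[%R -> is_derive s 1 f (expR (6 * L * s) *
    (2 * dot (D s) (D' s) + 6 * L * dot (D s) (D s))).
  rewrite in_itv/= => sT.
  have sT' : 0 <= s <= T by case/andP: sT => a b; rewrite !ltW.
  have d1 := is_derive_within_oo sT (is_derive_within_dot (dD _ sT') (dD _ sT')).
  have d2 : is_derive s 1 (fun s => expR (6 * L * s)) (6 * L * expR (6 * L * s)).
    have h : is_derive s 1 (fun s : R => 6 * L * s) (6 * L).
      have := is_deriveZ (6 * L) (is_derive_id s (1 : R)).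
      by rewrite [_ *: _]mulr1.
    rewrite [X in is_derive _ _ _ X]mulrC.
    exact: (is_derive1_comp (is_derive_expR (6 * L * s)) h).
  apply: (is_derive_eq (is_deriveM d2 d1)).
  by rewrite /GRing.scale/=; ring.
(* Continuity up to the end points, where only one-sided derivatives are known, comes from the
   Lipschitz bound of the flow. *)
have cf : {within `[0, T], continuous f}.
  apply/subspace_continuousP => s sT; rewrite /= in_itv/= in sT.
  apply: cvgM.
    apply: cvg_within_filter; apply: continuous_comp; last exact: continuous_expR.
    by apply: cvgM; [exact: cvg_cst | exact: cvg_id].
  have cPhi Z : Gamma0 Z -> Phi (Z, r) @[r --> within `[0, T] (nbhs s)] --> Phi (Z, s).
    move=> GZ; have : {within `[0, T], continuous (fun r => Phi (Z, r))}.
      apply: (@lipschitz_within_continuous _ _ _ _ _ LP) => // a b aT bT.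
      rewrite (le_trans (PhiL _ _ _ _))// ler_wpM2l// prod_normE/= subrr normr0.
      by rewrite ge_max lexx normr_ge0.
    by move/subspace_continuousP; apply; rewrite /= in_itv.
  by apply: cvg_dot; apply: cvgB; exact: cPhi.
have fder (s : R) : s \in `]0, T[%R -> derivable f s 1 by move=> /df[].
have fge0 (s : R) : s \in `]0, T[%R -> 0 <= derive1 f s.
  move=> sT; have [_ dfs] := df s sT; rewrite derive1E dfs mulr_ge0 ?expR_ge0//.
  rewrite in_itv/= in sT; have sT' : 0 <= s <= T by case/andP: sT => a b; rewrite !ltW.
  have h1 := norm_dot_le (D s) (D' s).
  have h2 : `|D' s| <= L * `|D s|.
    have QX := flow_closed_spacetime GX sT'.
    have QY := flow_closed_spacetime GY sT'.
    rewrite (le_trans (velL _ _ QX QY))//.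
    by rewrite ler_wpM2l// prod_normE/= subrr normr0 ge_max lexx normr_ge0.
  have h3 : `|D s| * `|D' s| <= L * dot (D s) (D s).
    rewrite (@le_trans _ _ (L * `|D s| ^+ 2))//; last first.
      by rewrite ler_wpM2l// sqr_norm_le_dot.
    by rewrite expr2 mulrCA ler_wpM2l.
  move: h1; rewrite ler_norml => /andP[h1 _]; lra.
have in0 : 0 \in `[0, T]%R by rewrite in_itv/= lexx ltW.
have int : t \in `[0, T]%R by rewrite in_itv/= t0.
have := ger0_derive1_le_cc fder fge0 cf in0 int t0.
rewrite /f mulr0 expR0 mul1r /D !(es_flow0 Hes)// => f0t.
rewrite -[leRHS]ger0_norm ?mulr_ge0 ?sqrtr_ge0//.
rewrite -[leLHS]ger0_norm// -ler_sqr ?nnegrE//.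
rewrite !real_normK ?num_real// exprMn sqr_sqrtr ?mulr_ge0 ?expR_ge0//.
rewrite (le_trans (sqr_norm_le_dot _))// (le_trans f0t)// -[leRHS]mulrA ler_pM ?expR_ge0 ?dot_ge0//.
  by rewrite ler_expR ler_wpM2l// mulr_ge0.
exact: dot_le_sqr_norm.
Qed.

Lemma enorm_nu x t : Q (x, t) -> enorm (nu (x, t)) = 1.
Proof. by move=> /(es_normal Hes)[[]]. Qed.

Lemma norm_nu_dot x t a : Q (x, t) -> `|dot (nu (x, t)) a| <= 3 * `|a|.
Proof.
move=> xt; rewrite (le_trans (norm_dot_le _ _))// ler_wpM2l// ler_piMl//.
by rewrite (le_trans (norm_le_enorm _))// enorm_nu.
Qed.

(** Expand the extension of [Phi] to second order in the direction (Y - X, 0). The secant Y - X of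
    [Gamma0] is a tangent vector up to a quadratic error, and by [tangent_push] the image of that
    vector is orthogonal to the normal of Gamma(t). *)
Lemma normal_secant_local z0 : K z0 -> exists C r : R, 0 < r /\
  forall z w, K z -> K w -> `|z - z0| < r -> `|w - z0| < r -> z.2 = w.2 ->
  `|dot (nu (Phi z, z.2)) (Phi w - Phi z)| <= C * `|w - z| ^+ 2.
Proof.
move=> Kz0; have [U [g [[zU gP] gC]]] := es_flow_smooth Hes Kz0.
have [C1 [r1 [C10 r10 g1]]] := C1_derive_bounded coordinates_rVR zU (gC 1%N).
have [C2 [r2 [C20 r20 g2]]] := C2_taylor coordinates_rVR zU (gC 2%N).
have [C3 [r3 [C30 r30 secant]]] := surface_secant (es_smooth Hes) Kz0.1.
(* [C2] is the Taylor remainder, [C1 * C3] the differential applied to the non-tangential part of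
   the secant, and 3 the factor in [norm_nu_dot]. *)
exists (3 * (C2 + C1 * C3)), (Num.min r1 (Num.min r2 r3)).
split; first by rewrite !lt_min r10 r20 r30.
have normz (z : 'rV[R]_3 * R) : `|z.1| <= `|z| by rewrite prod_normE le_max lexx.
move=> [X t] [Y s] Kz Kw; rewrite !lt_min => /and3P[zr1 zr2 zr3].
move=> /and3P[wr1 wr2 wr3] /= ts; subst s.
have [/= GX tT] := Kz; have [/= GY _] := Kw; rewrite in_itv/= in tT.
have [w1 [tw1 w1P]] := secant _ _ GX GY
  (le_lt_trans (normz _) zr3) (le_lt_trans (normz _) wr3).
have [UX dg gb] := g1 _ zr1; have [UY _ _] := g1 _ wr1.
have QX := flow_closed_spacetime GX tT.
have perp : dot (nu (Phi (X, t), t)) ('D_((w1, 0)) g (X, t)) = 0.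
  have [[_ +] _] := es_normal Hes QX; apply.
  by apply: (tangent_push _ UX dg gP) => //; case: zU.
have := g2 _ _ zr2 wr2.
have wz : (Y, t) - (X, t) = (Y - X, 0) :> 'rV[R]_3 * R.
  by apply: injective_projections => //=; rewrite subrr.
have nwz : `|(Y - X, 0) : 'rV[R]_3 * R| = `|Y - X|.
  by rewrite prod_normE/= normr0; apply/max_idPl.
rewrite wz !gP// nwz => taylor.
have split_dir : 'D_((Y - X, 0)) g (X, t) =
    'D_((Y - X - w1, 0)) g (X, t) + 'D_((w1, 0)) g (X, t).
  rewrite !deriveE// -linearD; congr ('d _ _ _).
  by apply: injective_projections; rewrite /= ?subrK ?addr0.
have := gb (Y - X - w1, 0).
rewrite (_ : `|(Y - X - w1, 0)| = `|Y - X - w1|); last first.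
  by rewrite prod_normE/= normr0; apply/max_idPl.
move=> gbw.
rewrite -[Phi (Y, t) - Phi (X, t)](subrK ('D_((Y - X, 0)) g (X, t))).
rewrite [X in _ + X]split_dir addrA dotDr perp addr0.
rewrite (le_trans (norm_nu_dot _ QX))// -mulrA ler_wpM2l//.
rewrite mulrDl (le_trans (ler_normD _ _))// lerD//.
by rewrite (le_trans gbw)// -mulrA ler_wpM2l.
Qed.

(** Compactness makes the local estimate uniform for |X - Y| < d. For distant points the linear
    bound 3L|Y - X| is already at most (3L/d)|Y - X|^2. *)
Lemma normal_secant_slice : exists2 C : R, 0 <= C & forall X Y t,
  Gamma0 X -> Gamma0 Y -> 0 <= t <= T ->
  `|dot (nu (Phi (X, t), t)) (Phi (Y, t) - Phi (X, t))| <= C * `|Y - X| ^+ 2.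
Proof.
have [L L0 PhiL] := flow_lipschitz.
have [|z Kz|C [d [C0 d0 CP]]] := @compact_near_diagonal _ _ K (fun C z w =>
    z.2 = w.2 -> `|dot (nu (Phi z, z.2)) (Phi w - Phi z)| <= C * `|w - z| ^+ 2)
    flow_domain_compact.
- move=> C C' z w CC' H /H /le_trans; apply.
  by rewrite ler_wpM2r ?sqr_ge0.
- by have [C [r [r0 H]]] := normal_secant_local Kz; exists C, r.
exists (C + 3 * L / d); first by rewrite addr_ge0// divr_ge0 ?mulr_ge0// ltW.
move=> X Y t GX GY tT; rewrite mulrDl.
have Kt Z : Gamma0 Z -> K (Z, t) by split => //=; rewrite in_itv.
have nYX (Z W : 'rV[R]_3) : `|(Z, t) - (W, t) : 'rV[R]_3 * R| = `|Z - W|.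
  by rewrite prod_normE/= subrr normr0; apply/max_idPl.
have [dYX|dYX] := ltP `|X - Y| d.
  have := CP (X, t) (Y, t) (Kt _ GX) (Kt _ GY); rewrite !nYX => /(_ dYX erefl).
  by move=> /le_trans; apply; rewrite lerDl mulr_ge0 ?sqr_ge0// divr_ge0 ?mulr_ge0// ltW.
rewrite (le_trans (norm_nu_dot _ (flow_closed_spacetime GX tT)))//.
rewrite (@le_trans _ _ (3 * L * `|Y - X|))//.
  by rewrite -mulrA ler_wpM2l// (le_trans (PhiL _ _ (Kt _ GY) (Kt _ GX)))// nYX.
rewrite -[leLHS]add0r lerD ?mulr_ge0 ?sqr_ge0//.
rewrite -!mulrA !ler_wpM2l// ler_pdivlMl// expr2 ler_wpM2r//.
by rewrite distrC.
Qed.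

(* As y is not on the slice of x, the estimate on the slice Gamma(t) is applied
   to the point reached at time t by the trajectory through y. *)
Lemma normal_secant : exists2 C : R, 0 <= C & forall x t y s,
  Q (x, t) -> Q (y, s) ->
  `|dot (nu (x, t)) (x - y)| <= C * (`|x - y| ^+ 2 + `|t - s|).
Proof.
have [L L0 PhiL] := flow_lipschitz.
have [E E0 PhiE] := flow_expanding.
have [C C0 CP] := normal_secant_slice.
have T0 := es_time Hes.
(* [E] carries distances in Gamma(t) back to the labels X and Y, in which the slice estimate is
   stated; the factor 2 comes from (p + q)^2 <= 2(p^2 + q^2). *)
pose D := 2 * C * E ^+ 2.
have D0 : 0 <= D by rewrite !mulr_ge0// sqr_ge0.
have L20 : 0 <= L ^+ 2 by rewrite sqr_ge0.
exists (D + D * L ^+ 2 * T + 3 * L).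
  by rewrite !addr_ge0// !mulr_ge0// ltW.
move=> x t y s [/= tT [X GX <-]] [/= sT [Y GY <-]].
have QX := flow_closed_spacetime GX tT.
set x' := Phi (X, t); set y' := Phi (Y, t); set y'' := Phi (Y, s).
have hy : `|y' - y''| <= L * `|t - s|.
  have Kt : K (Y, t) by split => //=; rewrite in_itv.
  have Ks : K (Y, s) by split => //=; rewrite in_itv.
  rewrite (le_trans (PhiL _ _ Kt Ks))// prod_normE/= subrr normr0.
  by rewrite ler_wpM2l// ge_max lexx normr_ge0.
have h1 := CP X Y t GX GY tT.
have h2 := norm_nu_dot (y' - y'') QX.
have h3 := PhiE X Y t GX GY tT; rewrite -/x' -/y' in h1 h3.
have h4 : `|x' - y'| <= `|x' - y''| + L * `|t - s|.
  rewrite -(subrKA y'') (le_trans (ler_normD _ _))// lerD2l.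
  by rewrite distrC.
have h5 : `|Y - X| ^+ 2 <= E ^+ 2 * (2 * (`|x' - y''| ^+ 2 + L ^+ 2 * (T * `|t - s|))).
  apply: (@le_trans _ _ ((E * (`|x' - y''| + L * `|t - s|)) ^+ 2)).
    rewrite lerXn2r ?nnegrE ?mulr_ge0 ?addr_ge0 ?mulr_ge0// distrC (le_trans h3)//.
    by rewrite ler_wpM2l.
  rewrite exprMn ler_wpM2l ?sqr_ge0//.
  apply: (@le_trans _ _ (2 * (`|x' - y''| ^+ 2 + (L * `|t - s|) ^+ 2))).
    have := sqr_ge0 (`|x' - y''| - L * `|t - s|); nra.
  (* One factor of |t - s|^2 is bounded by T, which leaves a linear term. *)
  rewrite ler_wpM2l// lerD2l exprMn ler_wpM2l// expr2 ler_wpM2r//.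
  by rewrite ler_norml; move: tT sT; lra.
have h6 : `|dot (nu (x', t)) (x' - y'')| <=
    `|dot (nu (x', t)) (y' - x')| + `|dot (nu (x', t)) (y' - y'')|.
  have -> : x' - y'' = (y' - y'') - (y' - x') by rewrite opprB [RHS]addrC subrKA.
  by rewrite dotBr [leRHS]addrC; exact: ler_normB.
have h7 : C * `|Y - X| ^+ 2 <= D * `|x' - y''| ^+ 2 + D * L ^+ 2 * T * `|t - s|.
  apply: le_trans (ler_wpM2l C0 h5) _; rewrite /D; lra.
(* [h8] and [h9] raise the separate coefficients of |x - y|^2 and |t - s| to the common constant. *)
have h8 : 0 <= (D * L ^+ 2 * T + 3 * L) * `|x' - y''| ^+ 2.
  by rewrite mulr_ge0 ?sqr_ge0// addr_ge0 ?mulr_ge0// ltW.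
have h9 : 0 <= D * `|t - s| by rewrite mulr_ge0.
have h10 : 3 * `|y' - y''| <= 3 * (L * `|t - s|) by rewrite ler_wpM2l.
lra.
Qed.

End EvolvingSurfaceGeometry.

(** * Quadratic test functions *)

Lemma differentiable_fst {R : realType} {V W : normedModType R} (z : V * W) :
  differentiable fst z.
Proof. by apply: linear_differentiable => y; exact: cvg_fst. Qed.

Lemma differentiable_snd {R : realType} {V W : normedModType R} (z : V * W) :
  differentiable snd z.
Proof. by apply: linear_differentiable => y; exact: cvg_snd. Qed.

Section QuadraticTest.
Context {R : realType} {n : nat}.
Local Notation E := 'rV[R]_n.
Variables (a b c : R) (w : E * R).

(** The doubling penalty with its second point frozen at [w]; the linear term is the penalty sigma
    t. One family serves both solutions, see [quadC]. *)
Definition quad (z : E * R) : R :=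
  a * dot (z.1 - w.1) (z.1 - w.1) + b * (z.2 - w.2) ^+ 2 + c * z.2.

Definition dquad (v z : E * R) : R :=
  2 * a * dot v.1 (z.1 - w.1) + 2 * b * (v.2 * (z.2 - w.2)) + c * v.2.

Lemma quad_differentiable z : differentiable quad z.
Proof.
have d2 := @differentiable_snd R E R z.
have d1 i : differentiable (fun z : E * R => (z.1 - w.1) 0 i) z.
  apply: (@differentiable_comp _ _ _ _ (fun z : E * R => z.1 - w.1)
    (fun x : E => x 0 i)); last exact: differentiable_coord.
  by apply: differentiableB; [exact: differentiable_fst | exact: differentiable_cst].
apply: differentiableD; last by apply: differentiableM.
apply: differentiableD; last first.
  apply: differentiableM; first exact: differentiable_cst.
  have dB : differentiable (fun z : E * R => z.2 - w.2) z.
    by apply: differentiableB.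
  exact: (differentiableM dB dB).
apply: differentiableM => //.
rewrite /dot (_ : (fun _ => _) = \sum_(i < n) (fun z : E * R =>
    (z.1 - w.1) 0 i * (z.1 - w.1) 0 i)).
  by apply: differentiable_sum => i; by apply: differentiableM.
by apply/funext => y; rewrite fct_sumE.
Qed.

Lemma quad_derive v z : 'D_v quad z = dquad v z.
Proof.
suff cq : h^-1 *: (quad (h *: v + z) - quad z) @[h --> 0^'] --> dquad v z.
  exact: cvg_lim cq.
(* The difference quotient of a quadratic polynomial equals its derivative plus a remainder exactly
   linear in [h]. *)
have : dquad v z + h * (a * dot v.1 v.1 + b * v.2 ^+ 2) @[h --> 0^']
    --> dquad v z + 0 * (a * dot v.1 v.1 + b * v.2 ^+ 2).
  apply: cvgD; first exact: cvg_cst.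
  apply: cvgM; last exact: cvg_cst.
  exact: nbhs_dnbhs.
rewrite mul0r addr0; apply: cvg_trans; apply: near_eq_cvg.
near=> h; have h0 : h != 0 by near: h; exact: nbhs_dnbhs_neq.
rewrite /quad /dquad /= -(addrA (h *: v.1)) (dot_sqrD (h *: v.1)) !dotZr.
rewrite !(dotC (h *: v.1)) !dotZr (dotC (z.1 - w.1) v.1) /GRing.scale/=.
by field.
Unshelve. all: by end_near. Qed.


Lemma dquad_continuous v : continuous (dquad v).
Proof.
move=> z; apply: cvgD; last exact: cvg_cst.
apply: cvgD; apply: cvgM; try exact: cvg_cst.
  apply: cvg_dot; first exact: cvg_cst.
  by apply: cvgB; [exact: cvg_fst | exact: cvg_cst].
apply: cvgM; first exact: cvg_cst.
by apply: cvgB; [exact: cvg_snd | exact: cvg_cst].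
Qed.

Lemma quad_C1 : is_Ck 1 [set: E * R] quad.
Proof.
split=> [z _|v z _] /=; first exact: quad_differentiable.
rewrite (_ : (fun _ => _) = dquad v); first exact: dquad_continuous.
by apply/funext => y; exact: quad_derive.
Qed.

Lemma quad_slice_derive (t : R) (v x : E) :
  'D_v (fun y => quad (y, t)) x = dquad (v, 0) (x, t).
Proof.
have line h : (h *: v + x, t) = h *: (v, 0) + (x, t) :> E * R.
  by apply: injective_projections; rewrite /= ?scaler0 ?add0r.
by rewrite -quad_derive /derive; under eq_fun do rewrite /= line.
Qed.

Lemma quad_slice_C1 (t : R) : is_Ck 1 [set: E] (fun x => quad (x, t)).
Proof.
split=> [x _|v x _] /=.
  apply: (@differentiable_comp _ _ _ _ (fun x : E => (x, t)) quad).
    exact: differentiable_pair.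
  exact: quad_differentiable.
rewrite (_ : (fun _ => _) = dquad (v, 0) \o (fun x => (x, t))); last first.
  by apply/funext => y; exact: quad_slice_derive.
apply: continuous_comp; last exact: dquad_continuous.
by apply: differentiable_continuous; exact: differentiable_pair.
Qed.

Lemma quad_slice_gradient (t : R) (x : E) :
  gradient (fun y => quad (y, t)) x = (2 * a) *: (x - w.1).
Proof.
apply/rowP => i; rewrite !mxE quad_slice_derive /dquad /= mul0r !mulr0 !addr0.
congr (_ * _); rewrite /dot (bigD1 i)//= big1 ?addr0 => [|j ji].
  by rewrite !mxE !eqxx mul1r.
by rewrite !mxE (negbTE ji) andbF mul0r.
Qed.

End QuadraticTest.

Lemma quadC {R : realType} {n : nat} (a b c : R) (z w : 'rV[R]_n * R) :
  quad (- a) (- b) 0 w z = c * w.2 - quad a b c z w.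
Proof.
rewrite /quad -(opprB w.1 z.1) dotNr dotC dotNr opprK; ring.
Qed.

Lemma is_derive_within_sqr {R : realType} (I : set R) (t s : R) :
  is_derive_within I (fun r => (r - s) ^+ 2 : R^o) t (2 * (t - s)).
Proof.
(* This is the difference quotient of (r - s)^2 at [t], cleared of its denominator. *)
have : r + (t - 2 * s) @[r --> within I t^'] --> t + (t - 2 * s).
  apply: cvgD; last exact: cvg_cst.
  exact: is_derive_within_cvg (is_derive_within_id I t).
rewrite (_ : t + (t - 2 * s) = 2 * (t - s) :> R); last by ring.
apply: cvg_trans; apply: near_eq_cvg.
near=> r; have rt : r - t != 0.
  by rewrite subr_eq0; near: r; exact: within_dnbhs_neq.
by rewrite /GRing.scale/=; field.
Unshelve. all: by end_near. Qed.

Lemma mul_tangential_projection {R : realType} (p n : 'rV[R]_3) :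
  p *m tangential_projection n = p - dot n p *: n.
Proof.
rewrite /tangential_projection mulmxBr mulmx1 mulmxA; congr (_ - _).
apply/rowP => j; rewrite !mxE big_ord1 mxE; congr (_ * _).
by apply: eq_bigr => i _; rewrite mxE mulrC.
Qed.

Lemma usc_on_near {R : realType} {X : topologicalType} (A : set X) (f : X -> R) :
  usc_on A f -> forall x, A x -> forall e, 0 < e ->
  \forall y \near within A (nbhs x), f y < f x + e.
Proof.
move=> uscf x Ax e e0.
have := uscf x (- (f x + e)); rewrite lte_fin ltrN2 ltrDl => /(_ e0)[V xV VP].
rewrite (nbhs_subspace_in Ax); apply: filterS xV => y /VP.
by rewrite lte_fin ltrN2.
Qed.

Lemma lsc_on_near {R : realType} {X : topologicalType} (A : set X) (f : X -> R) :
  lsc_on A f -> forall x, A x -> forall e, 0 < e ->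
  \forall y \near within A (nbhs x), f x - e < f y.
Proof.
move=> lscf x Ax e e0.
have := lscf x (f x - e); rewrite lte_fin gtrBl => /(_ e0)[V xV VP].
by rewrite (nbhs_subspace_in Ax); apply: filterS xV => y /VP; rewrite lte_fin.
Qed.

(** * Doubling of variables *)

Section Comparison.
Context {R : realType}.
Local Notation E := 'rV[R]_3.
Variables (Gamma0 : set E) (T : R) (Phi vel nu : E * R -> E).
Hypothesis Hes : evolving_surface Gamma0 T Phi vel nu.
Local Notation Q := (closed_spacetime Gamma0 T Phi).

Lemma quad_material_derivative (a b c : R) (w : E * R) x t : Q (x, t) ->
  is_material_derivative Gamma0 T Phi (quad a b c w) x t
    (2 * a * dot (x - w.1) (vel (x, t)) + 2 * b * (t - w.2) + c).
Proof.
move=> [/= tT [X GX Xx]]; exists X; split => //.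
have dPhi : is_derive_within `[0, T] (fun s => Phi (X, s) - w.1) t (vel (x, t)).
  rewrite -[vel (x, t)]subr0 -Xx; apply: is_derive_withinB.
    exact: (es_flow_velocity Hes).
  exact: is_derive_within_cst.
have d1 := is_derive_withinZ (k := a) (is_derive_within_dot dPhi dPhi).
have d2 := is_derive_withinZ (k := b) (@is_derive_within_sqr R `[0, T] t w.2).
have d3 := is_derive_withinZ (k := c) (@is_derive_within_id R `[0, T] t).
have := is_derive_withinD (is_derive_withinD d1 d2) d3.
rewrite Xx /GRing.scale/= mulr1.
by congr is_derive_within; ring.
Qed.

Lemma quad_tangential_gradient (a b c : R) (w : E * R) x t :
  is_tangential_gradient (surface_at Gamma0 Phi t) (nu (x, t))
    (fun y => quad a b c w (y, t)) x
    ((2 * a) *: (x - w.1 - dot (nu (x, t)) (x - w.1) *: nu (x, t))).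
Proof.
exists setT, (fun y => quad a b c w (y, t)); split.
- by split => //; split => //; exact: openT.
- exact: quad_slice_C1.
- by rewrite quad_slice_gradient mul_tangential_projection dotZr scalerBr scalerA.
Qed.

Lemma quad_C1_on (a b c : R) (w : E * R) : Ck_on 1 Q (quad a b c w).
Proof.
move=> z Qz; exists setT, (quad a b c w); split; last exact: quad_C1.
by split => //; split => //; exact: openT.
Qed.

Variables (H : E * R -> E -> R) (u0 : E -> R).

(** For these test functions both operators are explicit, which reduces the viscosity condition to a
    numerical inequality. The doubling yields a maximum over all of [Q], hence a local one. *)
Lemma subsolution_quad (u : E * R -> R) (a b c : R) (w : E * R) x t :
  viscosity_subsolution Gamma0 T Phi nu H u0 u -> Q (x, t) -> 0 < t ->
  (forall z, Q z -> u z - quad a b c w z <= u (x, t) - quad a b c w (x, t)) ->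
  2 * a * dot (x - w.1) (vel (x, t)) + 2 * b * (t - w.2) + c + H (x, t)
    ((2 * a) *: (x - w.1 - dot (nu (x, t)) (x - w.1) *: nu (x, t))) <= 0.
Proof.
move=> [_ _ _ subu] Qx t0 xmax.
apply: (subu _ (quad_C1_on a b c w) x t t0).
- split => //; change (nbhs (x, t) (fun z => Q z ->
    u z - quad a b c w z <= u (x, t) - quad a b c w (x, t))).
  by apply: filterE => z; exact: xmax.
- exact: quad_material_derivative.
- exact: quad_tangential_gradient.
Qed.

Lemma supersolution_quad (v : E * R -> R) (a b c : R) (w : E * R) x t :
  viscosity_supersolution Gamma0 T Phi nu H u0 v -> Q (x, t) -> 0 < t ->
  (forall z, Q z -> v (x, t) - quad a b c w (x, t) <= v z - quad a b c w z) ->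
  0 <= 2 * a * dot (x - w.1) (vel (x, t)) + 2 * b * (t - w.2) + c + H (x, t)
    ((2 * a) *: (x - w.1 - dot (nu (x, t)) (x - w.1) *: nu (x, t))).
Proof.
move=> [_ _ _ supv] Qx t0 xmin.
apply: (supv _ (quad_C1_on a b c w) x t t0).
- split => //; change (nbhs (x, t) (fun z => Q z ->
    v (x, t) - quad a b c w (x, t) <= v z - quad a b c w z)).
  by apply: filterE => z; exact: xmin.
- exact: quad_material_derivative.
- exact: quad_tangential_gradient.
Qed.

Variables (LH1 LH2 : R).
Hypotheses (HLH1 : 0 < LH1) (HLH2 : 0 < LH2).
Hypothesis HH1 : forall x t y s p, Q (x, t) -> Q (y, s) ->
  `|H (x, t) p - H (y, s) p|
    <= LH1 * (enorm (x - y) + `|t - s|) * (1 + enorm p).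
Hypothesis HH2 : forall x t p q, Q (x, t) ->
  `|H (x, t) p - H (x, t) q| <= LH2 * enorm (p - q).

(* The two gradients are the projections of 2a(x - y) on two different tangent
   planes; since x - y is almost tangent to both ([normal_secant]) they are close. *)
Lemma doubling_estimate : exists2 C : R, 0 <= C &
  forall x t y s (a b c eta : R), Q (x, t) -> Q (y, s) -> 0 <= a ->
  0 <= eta <= 1 ->
  a * `|x - y| ^+ 2 <= eta -> a * `|t - s| <= eta ->
  `|x - y| <= eta -> `|t - s| <= eta ->
  2 * a * dot (x - y) (vel (x, t)) + 2 * b * (t - s) + c + H (x, t)
    ((2 * a) *: (x - y - dot (nu (x, t)) (x - y) *: nu (x, t))) <= 0 ->
  0 <= 2 * (- a) * dot (y - x) (vel (y, s)) + 2 * (- b) * (s - t) + 0 + H (y, s)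
    ((2 * (- a)) *: (y - x - dot (nu (y, s)) (y - x) *: nu (y, s))) ->
  c <= C * eta.
Proof.
have [L L0 velL] := vel_lipschitz Hes.
have [N N0 nuN] := normal_secant Hes.
(* The summands bound, in this order, the transport terms, the change of base point in [H] and the
   change of gradient in [H]. *)
exists (12 * L + 100 * LH1 + 24 * LH2 * N).
  by rewrite !addr_ge0// ?mulr_ge0// ltW.
move=> x t y s a b c eta Qx Qy a0 /andP[e0 e1] ar at_ re te.
set d := x - y; set rho := `|x - y| in ar re; set tau := `|t - s| in at_ te.
have rho0 : 0 <= rho by exact: normr_ge0.
have tau0 : 0 <= tau by exact: normr_ge0.
have -> : y - x = - d by rewrite opprB.
set p := (2 * a) *: _ => sub.
have -> : (2 * - a) *: (- d - dot (nu (y, s)) (- d) *: nu (y, s)) =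
    (2 * a) *: (d - dot (nu (y, s)) d *: nu (y, s)).
  by rewrite mulrN scaleNr -scalerN opprB dotNr scaleNr opprK addrC.
set q := (2 * a) *: _ => sup.
have nu1 z r : Q (z, r) -> `|nu (z, r)| <= 1.
  by move=> Qz; rewrite -(enorm_nu Hes Qz) norm_le_enorm.
have hv : `|dot d (vel (x, t) - vel (y, s))| <= 3 * (rho * (L * (rho + tau))).
  rewrite (le_trans (norm_dot_le _ _))// ler_wpM2l// ler_wpM2l//.
  rewrite (le_trans (velL _ _ Qx Qy))// ler_wpM2l// prod_normE/= ge_max.
  by rewrite lerDl lerDr rho0 tau0.
(* [a * rho] may be large; it is used below only after multiplication by [rho] or [tau]. The factor
   24 is 3 for [enorm], 2 from 2a and 4 from the projection. *)
have np : enorm p <= 24 * (a * rho).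
  rewrite (le_trans (enorm_le_norm _))// /p normrZ ger0_norm ?mulr_ge0//.
  have : `|d - dot (nu (x, t)) d *: nu (x, t)| <= 4 * rho.
    rewrite (le_trans (ler_normB _ _))// normrZ.
    have := ler_pM (normr_ge0 _) (normr_ge0 _) (norm_nu_dot Hes d Qx) (nu1 _ _ Qx).
    rewrite -/rho; lra.
  move=> /(ler_wpM2l (mulr_ge0 (ler0n R 6) a0)); lra.
have npq : enorm (p - q) <= 12 * N * (a * rho ^+ 2 + a * tau).
  rewrite (le_trans (enorm_le_norm _))// /p /q -scalerBr normrZ ger0_norm ?mulr_ge0//.
  (* The common part [d] cancels; the two remaining normal components are each small by
     [normal_secant]. *)
  have -> : d - dot (nu (x, t)) d *: nu (x, t) - (d - dot (nu (y, s)) d *: nu (y, s))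
      = dot (nu (y, s)) d *: nu (y, s) - dot (nu (x, t)) d *: nu (x, t).
    by rewrite opprB addrC subrKA.
  have h1 := nuN _ _ _ _ Qx Qy; have h2 := nuN _ _ _ _ Qy Qx.
  rewrite -[y - x]opprB dotNr !normrN (distrC s t) -/d -/rho -/tau in h2.
  rewrite -/d -/rho -/tau in h1.
  have : `|dot (nu (y, s)) d *: nu (y, s) - dot (nu (x, t)) d *: nu (x, t)|
      <= 2 * (N * (rho ^+ 2 + tau)).
    rewrite (le_trans (ler_normB _ _))// !normrZ.
    have := ler_pM (normr_ge0 _) (normr_ge0 _) h1 (nu1 _ _ Qx).
    have := ler_pM (normr_ge0 _) (normr_ge0 _) h2 (nu1 _ _ Qy).
    lra.
  move=> /(ler_wpM2l (mulr_ge0 (ler0n R 6) a0)); lra.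
(* 100 = 4 + 72 + 24: first [enorm d + tau] itself, then its product with [enorm p], split into
   multiples of a rho^2 and of a tau rho. *)
have h1 : LH1 * (enorm d + tau) * (1 + enorm p) <= LH1 * (100 * eta).
  rewrite -mulrA (ler_wpM2l (ltW HLH1))//.
  have ed : enorm d + tau <= 4 * eta.
    by have := enorm_le_norm d; rewrite -/rho; lra.
  have ed' : enorm d + tau <= 3 * rho + tau.
    by have := enorm_le_norm d; rewrite -/rho; lra.
  have ed0 : 0 <= enorm d + tau by rewrite addr_ge0// sqrtr_ge0.
  have ar0 : 0 <= a * rho by rewrite mulr_ge0.
  have h2 : (enorm d + tau) * enorm p <= (3 * rho + tau) * (24 * (a * rho)).
    by apply: ler_pM => //; exact: sqrtr_ge0.
  have h3 : a * tau * rho <= eta.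
    by rewrite -[eta]mulr1; apply: ler_pM => //; [rewrite mulr_ge0 | lra].
  have h4 : (3 * rho + tau) * (24 * (a * rho)) =
    72 * (a * rho ^+ 2) + 24 * (a * tau * rho) by ring.
  lra.
have h2 : LH2 * enorm (p - q) <= LH2 * (12 * N * (2 * eta)).
  rewrite (ler_wpM2l (ltW HLH2))// (le_trans npq)// ler_wpM2l ?mulr_ge0//; lra.
have h3 : 2 * a * (3 * (rho * (L * (rho + tau)))) <= 12 * L * eta.
  have h3 : a * tau * rho <= eta.
    by rewrite -[eta]mulr1; apply: ler_pM => //; [rewrite mulr_ge0 | lra].
  have : L * (a * rho ^+ 2 + a * tau * rho) <= L * (2 * eta).
    by rewrite ler_wpM2l//; lra.
  lra.
have h4 : - (2 * a * dot d (vel (x, t) - vel (y, s))) <=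
    2 * a * (3 * (rho * (L * (rho + tau)))).
  rewrite -mulrN ler_wpM2l ?mulr_ge0//.
  by move: hv; rewrite ler_norml => /andP[]; lra.
(* The difference of the two Hamiltonian terms is split at [H (y, s) p]. The time penalty adds 2b(t
   - s) to both viscosity inequalities and cancels in their difference. *)
have := HH1 p Qx Qy; have := HH2 p q Qy; rewrite -/d -/tau !ler_norml.
move=> /andP[k1 _] /andP[k2 _].
rewrite dotBr in h4; rewrite dotC dotNr dotC in sup.
lra.
Qed.
End Comparison.

(* Penalising |x - y|^2 by [a] but |t - s|^2 by [a ^+ 4] makes [a * |t - s|] small
   as well. *)
Lemma doubling_maximum {R : realType} (Q : set ('rV[R]_3 * R))
    (u v : 'rV[R]_3 * R -> R) (sigma eta : R) z0 :
  compact Q -> usc_on Q u -> lsc_on Q v ->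
  (forall z, Q z -> 0 <= z.2) ->
  (forall z, Q z -> z.2 = 0 -> u z <= v z) ->
  Q z0 -> 0 < u z0 - v z0 - sigma * z0.2 -> 0 <= sigma -> 0 < eta <= 1 ->
  exists a z w, [/\ 0 <= a, Q z, Q w, 0 < z.2 & 0 < w.2] /\
    [/\ a * `|z.1 - w.1| ^+ 2 <= eta, a * `|z.2 - w.2| <= eta,
        `|z.1 - w.1| <= eta & `|z.2 - w.2| <= eta] /\
    forall z' w', Q z' -> Q w' ->
      u z' - v w' - quad a (a ^+ 4) sigma w' z' <=
      u z - v w - quad a (a ^+ 4) sigma w z.
Proof.
move=> cQ uscu lscv Q0 uv0 Qz0 pos0 s0 /andP[e0 e1].
have uscD a b p : Q p.1 -> Q p.2 -> forall e, 0 < e ->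
    \forall q \near within (Q `*` Q) (nbhs p),
      u q.1 - v q.2 - quad a b sigma q.2 q.1 <
      u p.1 - v p.2 - quad a b sigma p.2 p.1 + e.
  move=> Qp1 Qp2 e e_gt0.
  have e30 : 0 < e / 3 by rewrite divr_gt0.
  have hu := usc_on_near uscu Qp1 e30; have hv := lsc_on_near lscv Qp2 e30.
  have cq : quad a b sigma q.2 q.1 @[q --> p] --> quad a b sigma p.2 p.1.
    have c1 : q.1 @[q --> p] --> p.1 by exact: cvg_fst.
    have c2 : q.2 @[q --> p] --> p.2 by exact: cvg_snd.
    have c11 : q.1.1 @[q --> p] --> p.1.1 by apply: cvg_comp c1 _; exact: cvg_fst.
    have c12 : q.1.2 @[q --> p] --> p.1.2 by apply: cvg_comp c1 _; exact: cvg_snd.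
    have c21 : q.2.1 @[q --> p] --> p.2.1 by apply: cvg_comp c2 _; exact: cvg_fst.
    have c22 : q.2.2 @[q --> p] --> p.2.2 by apply: cvg_comp c2 _; exact: cvg_snd.
    have cB : q.1.2 - q.2.2 @[q --> p] --> p.1.2 - p.2.2 by exact: cvgB.
    apply: cvgD; last by apply: cvgM => //; exact: cvg_cst.
    apply: cvgD; apply: cvgM; try exact: cvg_cst; last exact: cvgM.
    by apply: cvg_dot; exact: cvgB.
  have cq' : \forall q \near p, quad a b sigma p.2 p.1 - e / 3 < quad a b sigma q.2 q.1.
    by apply: (cvgr_gt _ cq); rewrite gtrBl.
  have hu' : \forall q \near p, Q q.1 -> u q.1 < u p.1 + e / 3.
    exact: (@cvg_fst _ _ (nbhs p.1) (nbhs p.2) _ _ hu).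
  have hv' : \forall q \near p, Q q.2 -> v p.2 - e / 3 < v q.2.
    exact: (@cvg_snd _ _ (nbhs p.1) (nbhs p.2) _ _ hv).
  change (nbhs p (fun q => (Q `*` Q) q -> u q.1 - v q.2 - quad a b sigma q.2 q.1 <
      u p.1 - v p.2 - quad a b sigma p.2 p.1 + e)).
  near=> q; case=> Qq1 Qq2.
  have H1 : u q.1 < u p.1 + e / 3 by move: Qq1; near: q.
  have H2 : v p.2 - e / 3 < v q.2 by move: Qq2; near: q.
  have H3 : quad a b sigma p.2 p.1 - e / 3 < quad a b sigma q.2 q.1 by near: q.
  lra.
have cQQ : compact (Q `*` Q) by exact: compact_setX.
have QQ0 : (Q `*` Q) !=set0 by exists (z0, z0).
have maxD a b : exists2 p, (Q `*` Q) p & forall q, (Q `*` Q) q ->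
    u q.1 - v q.2 - quad a b sigma q.2 q.1 <=
    u p.1 - v p.2 - quad a b sigma p.2 p.1.
  by apply: usc_has_max => // p [Qp1 Qp2]; exact: uscD.
(* The doubled function without quadratic penalty, that is with coefficients 0, 0 in [quad]. Its
   maximum over all pairs bounds it globally; its maximum [M] over the diagonal is the reference
   level. *)
pose F z w := u z - v w - sigma * z.2.
have quad0 z w : quad 0 0 sigma w z = sigma * z.2 by rewrite /quad !mul0r !add0r.
have [[zB wB] [/= QzB QwB] FB] := maxD 0 0.
have {}FB z w : Q z -> Q w -> F z w <= F zB wB.
  by move=> Qz Qw; have := FB (z, w) (conj Qz Qw); rewrite !quad0.
have Fnear z : Q z -> forall e, 0 < e -> exists2 r : R, 0 < r &
    forall z' w', Q z' -> Q w' -> `|z' - z| < r -> `|w' - z| < r ->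
    F z' w' < F z z + e.
  move=> Qz e e_gt0; have := uscD 0 0 (z, z) Qz Qz e e_gt0.
  move=> /near_ball[r r0 rP]; exists r => // z' w' Qz' Qw' zr wr.
  have := rP (z', w'); rewrite !quad0; apply => //.
  by rewrite prod_normE/= gt_max zr.
have [zm Qzm Fm] : exists2 zm, Q zm & forall z, Q z -> F z z <= F zm zm.
  apply: (@usc_has_max _ _ Q (fun z => F z z)) => //; first by exists z0.
  move=> z Qz e e_gt0; have [r r0 rP] := Fnear z Qz e e_gt0.
  change (nbhs z (fun y => Q y -> F y y < F z z + e)).
  by apply: (@ball_near _ _ z r _ r0) => y yr Qy; exact: rP.
set M := F zm zm in Fm.
have M0 : 0 < M by exact: lt_le_trans (Fm _ Qz0).
have loc z : Q z -> exists C r : R, 0 < r /\ forall x y, Q x -> Q y ->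
    `|x - z| < r -> `|y - z| < r ->
    F x y < M + eta /\ (x.2 = 0 \/ y.2 = 0 -> F x y < M).
  move=> Qz.
  have [r1 r10 r1P] := Fnear z Qz eta e0.
  have [r2 r20 r2P] := Fnear z Qz M M0.
  have Fz := Fm _ Qz.
  (* At time 0 the diagonal value is at most 0 < M by the initial ordering, so nearby values stay
     below [M]. At a positive time the radius [z.2] excludes points of time 0. *)
  have [z20|z20] := eqVneq z.2 0.
    have Fz0 : F z z <= 0 by rewrite /F z20 mulr0 subr0 subr_le0 uv0.
    exists 0, (Num.min r1 r2); split; first by rewrite lt_min r10.
    move=> x y Qx Qy; rewrite !lt_min => /andP[x1 x2] /andP[y1 y2].
    have := r1P _ _ Qx Qy x1 y1; have := r2P _ _ Qx Qy x2 y2.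
    move=> h2 h1; split=> [|_]; first by rewrite (lt_le_trans h1)// lerD2r.
    by rewrite (lt_le_trans h2)// -[leRHS]add0r lerD2r.
  have zpos : 0 < z.2 by rewrite lt_def z20 Q0.
  exists 0, (Num.min r1 z.2); split; first by rewrite lt_min r10.
  move=> x y Qx Qy; rewrite !lt_min => /andP[x1 x2] /andP[y1 y2].
  have := r1P _ _ Qx Qy x1 y1 => h1; split=> [|[x0|y0]];
    first by rewrite (lt_le_trans h1)// lerD2r.
    have : `|x.2 - z.2| <= `|x - z| by rewrite [leRHS]prod_normE le_max lexx orbT.
    by rewrite x0 sub0r normrN (ger0_norm (ltW zpos)) leNgt x2.
  have : `|y.2 - z.2| <= `|y - z| by rewrite [leRHS]prod_normE le_max lexx orbT.
  by rewrite y0 sub0r normrN (ger0_norm (ltW zpos)) leNgt y2.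
have [_ [d [_ d0 dP]]] := @compact_near_diagonal _ _ Q (fun _ z w =>
    F z w < M + eta /\ (z.2 = 0 \/ w.2 = 0 -> F z w < M)) cQ
    (fun _ _ _ _ _ => id) loc.
pose B := F zB wB - M.
have B0 : 0 <= B by rewrite subr_ge0; exact: FB.
(* The first summand gives a eta >= 1. The second makes a d^2 exceed the gap [B], which forces the
   maximum pair to be closer than [d]. *)
pose a := eta^-1 + (B + 1) / d ^+ 2.
have d20 : 0 < d ^+ 2 by rewrite exprn_gt0.
have einv : 1 <= eta^-1 by rewrite -[leLHS]invr1 lef_pV2 ?posrE.
have Bd : 0 <= (B + 1) / d ^+ 2.
  by apply: divr_ge0; [apply: addr_ge0; [exact: B0 | exact: ler01] | exact: ltW].
have a1 : 1 <= a by rewrite /a; lra.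
have a0 : 0 < a by exact: lt_le_trans a1.
have ae : 1 <= a * eta by rewrite -(ler_pdivrMr _ _ e0) mul1r /a lerDl.
have ad : B < a * d ^+ 2.
  rewrite -(ltr_pdivrMr _ _ d20) /a.
  have : B / d ^+ 2 < (B + 1) / d ^+ 2 by rewrite ltr_pM2r ?invr_gt0// ltrDl.
  lra.
(* As a >= 1, the time penalty dominates [a * tau ^+ 2], so the choice of [a] controls both
   components of z - w. *)
have a4 : a <= a ^+ 4 by rewrite -[leLHS]expr1 ler_weXn2l.
have [[z w] [/= Qz Qw] zwmax] := maxD a (a ^+ 4).
exists a, z, w.
have quadE z' w' : quad a (a ^+ 4) sigma w' z' =
    a * dot (z'.1 - w'.1) (z'.1 - w'.1) + a ^+ 4 * (z'.2 - w'.2) ^+ 2 + sigma * z'.2.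
  by [].
(* Comparison with the diagonal pair [(zm, zm)], where the quadratic penalty vanishes. *)
have pen : a * dot (z.1 - w.1) (z.1 - w.1) + a ^+ 4 * (z.2 - w.2) ^+ 2
    <= F z w - M.
  have := zwmax (zm, zm) (conj Qzm Qzm); rewrite !quadE /M /F /= !subrr.
  rewrite (_ : dot 0 0 = 0 :> R); last by rewrite /dot big1// => i _; rewrite mxE mul0r.
  by rewrite expr2 !mulr0; lra.
have rho2 := sqr_norm_le_dot (z.1 - w.1).
have tau2 : `|z.2 - w.2| ^+ 2 = (z.2 - w.2) ^+ 2 by rewrite real_normK ?num_real.
set rho := `|z.1 - w.1| in rho2 *; set tau := `|z.2 - w.2| in tau2 *.
have rho0 : 0 <= rho by exact: normr_ge0.
have tau0 : 0 <= tau by exact: normr_ge0.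
have arho : a * rho ^+ 2 <= a * dot (z.1 - w.1) (z.1 - w.1).
  by rewrite ler_wpM2l// ltW.
have ar0 : 0 <= a * rho ^+ 2 by rewrite mulr_ge0 ?sqr_ge0// ltW.
have at0 : 0 <= a ^+ 4 * tau ^+ 2 by rewrite mulr_ge0 ?sqr_ge0// exprn_ge0// ltW.
rewrite -tau2 in pen.
have FzwB : F z w - M <= B by rewrite lerD2r; exact: FB.
have zw : `|z - w| < d.
  have small r : 0 <= r -> a * r ^+ 2 <= B -> r < d.
    move=> r0 arB; rewrite -ltr_sqr ?nnegrE ?(ltW d0)//.
    by rewrite -(ltr_pM2l a0); exact: le_lt_trans ad.
  rewrite prod_normE/= gt_max -/rho -/tau; apply/andP; split; apply: small => //.
    lra.
  rewrite (@le_trans _ _ (a ^+ 4 * tau ^+ 2))//; last lra.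
  by rewrite ler_wpM2r// sqr_ge0.
(* Close to the diagonal the bound on the penalty improves from [B] to [eta]. A time equal to 0 is
   excluded, since it would give F z w < M while the penalty is nonnegative. *)
have [Fe F0] := dP _ _ Qz Qw zw.
have ar : a * rho ^+ 2 <= eta by lra.
(* The exponent 4 acts here: a^4 tau^2 <= 1 gives a tau <= 1/a <= eta. *)
have a2t : a ^+ 2 * tau <= 1.
  have : (a ^+ 2 * tau) ^+ 2 <= 1 by rewrite exprMn -exprM; lra.
  move: (a ^+ 2 * tau) => y y1; nra.
have at_ : a * tau <= eta.
  by rewrite -(ler_pM2l a0) mulrA -expr2 (le_trans a2t).
have pos r : Q r -> r.2 <> 0 -> 0 < r.2.
  by move=> /Q0; rewrite le_eqVlt => /orP[/eqP->|].
split; [split => //|split; [split => //|]]; rewrite ?(ltW a0)//.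
- by apply: pos => // zt; have := F0 (or_introl zt); lra.
- by apply: pos => // wt; have := F0 (or_intror wt); lra.
- rewrite -ler_sqr ?nnegrE ?(ltW e0)//.
  rewrite -(ler_pM2l a0) (le_trans ar)// expr2 mulrA.
  by rewrite -[leLHS]mul1r ler_wpM2r// ltW.
- by rewrite (le_trans _ at_)// -[leLHS]mul1r ler_wpM2r.
- by move=> z' w' Qz' Qw'; exact: (zwmax (z', w')).
Unshelve. all: by end_near. Qed.

(** * Contradiction at the doubled maximum point *)

Unset Implicit Arguments.

Theorem theorem3p1 (R : realType)
    (Gamma0 : set 'rV[R]_3) (T : R)
    (Phi vel nu : 'rV[R]_3 * R -> 'rV[R]_3)
    (Hes : evolving_surface Gamma0 T Phi vel nu)
    (u0 : 'rV[R]_3 -> R)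
    (Hu0 : {within surface_at Gamma0 Phi 0, continuous u0})
    (H : 'rV[R]_3 * R -> 'rV[R]_3 -> R) (LH1 LH2 : R)
    (HLH1 : 0 < LH1) (HLH2 : 0 < LH2)
    (HH1 : forall x t y s p,
       closed_spacetime Gamma0 T Phi (x, t) ->
       closed_spacetime Gamma0 T Phi (y, s) ->
       `|H (x, t) p - H (y, s) p|
         <= LH1 * (enorm (x - y) + `|t - s|) * (1 + enorm p))
    (HH2 : forall x t p q,
       closed_spacetime Gamma0 T Phi (x, t) ->
       `|H (x, t) p - H (x, t) q| <= LH2 * enorm (p - q))
    (u v : 'rV[R]_3 * R -> R)
    (Hu : viscosity_subsolution Gamma0 T Phi nu H u0 u)
    (Hv : viscosity_supersolution Gamma0 T Phi nu H u0 v)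
    (Huv0 : forall x, surface_at Gamma0 Phi 0 x -> u (x, 0) <= v (x, 0)) :
  forall x t, closed_spacetime Gamma0 T Phi (x, t) -> u (x, t) <= v (x, t).
Proof.
move=> x0 t0 Qx0; rewrite leNgt; apply/negP => uv_pos.
have T0 := es_time Hes.
pose m := u (x0, t0) - v (x0, t0).
have m0 : 0 < m by rewrite subr_gt0.
(* At least half of the gap [m] survives the time penalty, since sigma t0 <= sigma T = m/2. *)
pose sigma := m / (2 * T).
have T20 : 0 < 2 * T by rewrite mulr_gt0.
have s0 : 0 < sigma by rewrite divr_gt0.
have sT : sigma * (2 * T) = m by rewrite divfK// gt_eqF.
have [C C0 est] := doubling_estimate Hes HLH1 HLH2 HH1 HH2.
(* Chosen so that C eta < sigma, against [doubling_estimate]; C + 1 avoids a division by 0 when C =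
   0. *)
pose eta := Num.min 1 (sigma / (2 * (C + 1))).
have C10 : 0 < 2 * (C + 1) by rewrite mulr_gt0// ltr_wpDl.
have eta0 : 0 < eta by rewrite lt_min ltr01 divr_gt0.
have etaC : eta * (2 * (C + 1)) <= sigma.
  by rewrite -(ler_pdivlMr _ _ C10) ge_min lexx orbT.
have eta1 : eta <= 1 by rewrite ge_min lexx.
have [uscu _ _ _] := Hu; have [lscv _ _ _] := Hv.
have tT : t0 <= T by have [/andP[_]] := Qx0.
have pos0 : 0 < u (x0, t0) - v (x0, t0) - sigma * t0.
  have : sigma * t0 <= sigma * T by rewrite ler_wpM2l// ltW.
  rewrite -/m; lra.
have Q0 z : closed_spacetime Gamma0 T Phi z -> 0 <= z.2 by move=> [/andP[]].
have uv0 z : closed_spacetime Gamma0 T Phi z -> z.2 = 0 -> u z <= v z.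
  by case: z => x t [/= _ + t_0]; rewrite t_0; exact: Huv0.
have [a [[x t] [[y s] [[a0 Qx Qy tpos spos] [[e1 e2 e3 e4] xymax]]]]] :=
  doubling_maximum (closed_spacetime_compact Hes) uscu lscv Q0 uv0 Qx0 pos0
    (ltW s0) (introT andP (conj eta0 eta1)).
have sub := subsolution_quad Hes Hu Qx tpos (a := a) (b := a ^+ 4) (c := sigma)
  (w := (y, s)).
(* From the side of [v] the penalty enters with the opposite sign and is centred at [(x, t)]. *)
have sup := supersolution_quad Hes Hv Qy spos (a := - a) (b := - a ^+ 4) (c := 0)
  (w := (x, t)).
have /= sle := est x t y s a (a ^+ 4) sigma eta Qx Qy a0.
have : sigma <= C * eta.
  apply: sle => //; first by rewrite ltW.
    by apply: sub => z Qz; have := xymax _ _ Qz Qy; lra.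
  apply: sup => z Qz; rewrite !(quadC _ _ sigma).
  have := xymax _ _ Qx Qz; lra.
lra.
Qed.
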